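(* Let $r\ge1$, $\mathbf{m}=(m_1,\ldots,m_r)\in\mathbb{N}^r$, $m=m_1+\cdots+m_r$, $\mathbf{f}\in\mathbb{C}^r$ and $a,b,c\in\mathbb{C}$ be such that $(c-a-m)_{m}\ne0$, $(c-b-m)_{m}\ne0$, $(1+a+b-c)_m\ne0$. Then for all $x\in\mathbb{C}\setminus[1,\infty)$, $$ {}_{r+2}F_{r+1}\!\left(\begin{matrix}a,b,\mathbf{f}+\mathbf{m}\\ c,\mathbf{f}\end{matrix}\,\middle|\, x\right) =(1-x)^{c-a-b-m}\,{}_{m+2}F_{m+1}\!\left(\begin{matrix}c-a-m,c-b-m,\boldsymbol{\eta}+1\\ c,\boldsymbol{\eta}\end{matrix}\,\middle|\, x\right), $$ where $\boldsymbol{\eta}=(\eta_1,\ldots,\eta_m)$ are the roots of the polynomial $$ \hat{P}_m(t)=\sum_{k=0}^m\frac{(-1)^k(a)_k(-b-m)_k(t)_k(c-a-m-t)_{m-k}}{(c-a-m)_m(c-b-m)_k\,k!}\, {}_{r+2}F_{r+1}\!\left(\begin{matrix}-k,b,\mathbf{f}+\mathbf{m}\\ b+m-k+1,\mathbf{f}\end{matrix}\right). $$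
   Context: $(a)_k=\Gamma(a+k)/\Gamma(a)$. For vectors, $\mathbf{f}+\mathbf{m}$, $\boldsymbol{\eta}+1$ componentwise; a vector among hypergeometric parameters means its components are listed. ${}_pF_q(\mathbf{a};\mathbf{b};x)$ is the generalized hypergeometric function (principal branch on $\mathbb{C}\setminus[1,\infty)$), ${}_pF_q(\mathbf{a};\mathbf{b})$ its value at $1$ (here terminating). Powers of $1-x$ are principal branches. Roots are listed with multiplicity. *)

(* Defs.v *)
From Stdlib Require Import Reals List Arith.
From Coquelicot Require Import Coquelicot.
Open Scope C_scope.

Definition prodC (l : list C) : C := fold_right Cmult 1 l.
Fixpoint sumC (N : nat) (u : nat -> C) : C :=
  match N with
  | O => u O
  | S k => sumC k u + u (S k)
  end.

Fixpoint poch (a : C) (n : nat) : C :=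
  match n with
  | O => 1
  | S k => poch a k * (a + RtoC (INR k))
  end.

Definition hyp_term (A B : list C) (x : C) (n : nat) : C :=
  prodC (map (fun a => poch a n) A) / prodC (map (fun b => poch b n) B)
  * x ^ n / RtoC (INR (fact n)).

(** Value at 1 of a series terminating after index N (its terms vanish
    beyond N because of an upper parameter -N). *)
Definition hyp_at1_terminating (A B : list C) (N : nat) : C :=
  sumC N (hyp_term A B 1).

Definition slit (x : C) : Prop := ~ (Im x = 0%R /\ (1 <= Re x)%R).

(** "g is the principal branch of pFq(A;B;.)": g is holomorphic on the slit
    plane and coincides with the (convergent) power series on the unit disc.
    (The slit plane is connected, so this determines g uniquely.) *)
Definition is_pFq (A B : list C) (g : C -> C) : Prop :=
  (forall z, slit z -> @ex_derive C_AbsRing C_NormedModule g z) /\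
  (forall z, (Cmod z < 1)%R -> is_series (hyp_term A B z) (g z)).

Definition Cexp (z : C) : C :=
  (exp (Re z) * cos (Im z), exp (Re z) * sin (Im z))%R.

Definition Arg (z : C) : R :=
  let x := Re z in let y := Im z in
  if Rlt_dec 0 x then atan (y / x)
  else if Rlt_dec x 0 then
    (if Rle_dec 0 y then atan (y / x) + PI else atan (y / x) - PI)%R
  else if Rlt_dec 0 y then (PI / 2)%R
  else if Rlt_dec y 0 then (- (PI / 2))%R
  else 0%R.

Definition Clog (z : C) : C := (ln (Cmod z), Arg z).

Definition Cpow_principal (z s : C) : C := Cexp (s * Clog z).

(** z is not a non-positive integer (so that (z)_n <> 0 for all n). *)
Definition not_nonpos_int (z : C) : Prop := forall n : nat, z <> - RtoC (INR n).

Definition Phat (fs : list C) (ms : list nat) (a b c : C) (t : C) : C :=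
  let m := list_sum ms in
  let mC := RtoC (INR m) in
  let fm := map (fun p => fst p + RtoC (INR (snd p))) (combine fs ms) in
  sumC m (fun k =>
    let kC := RtoC (INR k) in
    (-1) ^ k * poch a k * poch (- b - mC) k * poch t k
      * poch (c - a - mC - t) (m - k)
      / (poch (c - a - mC) m * poch (c - b - mC) k * RtoC (INR (fact k)))
      * hyp_at1_terminating ((- kC) :: b :: fm) ((b + mC - kC + 1) :: fs) k).

(* Main.v *)
(* The coefficients (a)_n (b)_n Q(n) / ((c)_n n!) of the left-hand series involve a polynomial Q of
   degree m, so the binomial transform G_k of (b)_n Q(n) with exponent -b-m vanishes for k > m; up
   to normalisation G_k is the value at 1 occurring in the k-th term of P_m.  Inverting the
   transform writes the left-hand side as a combination, for k <= m, of
   x^k 2F1(a+k, b+m; c+k; x), and Euler's transformation (the Pfaff-Saalschuetz sum on coefficients)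
   turns each of these into (1-x)^(c-a-b-m) x^k 2F1(c-a, c-b-m+k; c+k; x).  The resulting
   coefficients carry the factor P_m(-n), which is the ratio (eta+1)_n / (eta)_n since P_m(0) = 1.
   This proves the identity near 0.  It extends to the slit plane by the identity theorem, obtained
   here without Cauchy's formula: Goursat's theorem in logarithmic polar coordinates gives the mean
   value property, hence the maximum modulus principle, and applying the latter to h / (z - z0)^N
   for all N propagates the vanishing of h along the segment from 0 to x. *)
Require Import Defs.
From Stdlib Require Import Reals List Arith Lra Lia ClassicalEpsilon.
From Coquelicot Require Import Coquelicot.
Open Scope C_scope.

(** The coefficient identities are kept free of division: a series is represented by its
    coefficients multiplied by [(c)_n n!], so that a product with a power of [1-x] becomes a
    binomially weighted sum and the identities are polynomial in the parameters, with no value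
    excluded. Apart from those inside [Q], denominators enter only when these sums are compared with
    [Phat] and with the given series. The analytic obstacle is that [F1] and [F2] are known only
    through differentiability on the slit plane and a power series on the unit disc;
    differentiability alone supplies no Taylor expansion at other points, hence no isolated zeros.
    Logarithmic coordinates turn a circle into a side of a rectangle, and periodicity of the
    exponential cancels the two adjacent sides, so integrals over intervals suffice. Division by
    [(z - z0)^N] meets no removable singularity, because the function divided vanishes on a whole
    neighbourhood. Near 0 the disc is shrunk until all terms decay like [4^(-n)], which makes the
    product of two series elementary. *)

Local Notation "# n" := (RtoC (INR n)) (at level 5, n at level 4).

(** * Pochhammer symbols and binomial sums *)

Lemma nC_S (n : nat) : # (S n) = # n + 1.
Proof. now rewrite S_INR, RtoC_plus. Qed.

Lemma nC_add (n k : nat) : # (n + k) = # n + # k.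
Proof. now rewrite plus_INR, RtoC_plus. Qed.

Lemma nC_neq_0 (n : nat) : n <> 0%nat -> # n <> 0.
Proof. intros Hn H. apply RtoC_inj in H. now apply (not_0_INR n). Qed.

Lemma poch_Sl (a : C) (n : nat) : poch a (S n) = a * poch (a + 1) n.
Proof.
  induction n as [|n IH].
  - simpl. ring.
  - change (poch a (S n) * (a + # (S n)) = a * (poch (a + 1) n * (a + 1 + # n))).
    rewrite IH, nC_S. ring.
Qed.

Lemma poch_add (a : C) (n k : nat) : poch a (n + k) = poch a n * poch (a + # n) k.
Proof.
  induction k as [|k IH].
  - rewrite Nat.add_0_r. simpl. ring.
  - rewrite Nat.add_succ_r. simpl. rewrite IH, nC_add. ring.
Qed.

Lemma poch_shift (a : C) (n k : nat) :
  poch a n * poch (a + # n) k = poch a k * poch (a + # k) n.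
Proof. now rewrite <- !poch_add, Nat.add_comm. Qed.

Lemma poch_neg_nat (n k : nat) : (n < k)%nat -> poch (- # n) k = 0.
Proof.
  intros H. replace k with (n + S (k - n - 1))%nat by lia.
  rewrite poch_add, poch_Sl. ring.
Qed.

Lemma poch_neq_0_le (a : C) (n k : nat) : (k <= n)%nat -> poch a n <> 0 -> poch a k <> 0.
Proof.
  intros H Hn E. apply Hn. replace n with (k + (n - k))%nat by lia.
  rewrite poch_add, E. ring.
Qed.

Lemma poch_neq_0 (a : C) (n : nat) : not_nonpos_int a -> poch a n <> 0.
Proof.
  intros Ha. induction n as [|n IH]; simpl.
  - apply C1_nz.
  - apply Cmult_neq_0; [exact IH|]. intros E. apply (Ha n).
    replace a with (a + # n - # n) by ring. rewrite E. ring.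
Qed.

(* [bsum N w] is [sum_i binom(N, i) w i (N - i)], presented through Pascal's rule so that
   its recursion is the Leibniz rule. *)
Fixpoint bsum (N : nat) (w : nat -> nat -> C) : C :=
  match N with
  | O => w O O
  | S k => bsum k (fun i j => w (S i) j + w i (S j))
  end.

Lemma bsum_ext (N : nat) (w w' : nat -> nat -> C) :
  (forall i j, (i + j = N)%nat -> w i j = w' i j) -> bsum N w = bsum N w'.
Proof.
  revert w w'. induction N as [|N IH]; intros w w' H; simpl.
  - now apply H.
  - apply IH. intros i j Hij. rewrite !H by lia. reflexivity.
Qed.

Lemma bsum_plus (N : nat) (w w' : nat -> nat -> C) :
  bsum N (fun i j => w i j + w' i j) = bsum N w + bsum N w'.
Proof.
  revert w w'. induction N as [|N IH]; intros w w'; simpl; [reflexivity|].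
  rewrite <- IH. apply bsum_ext. intros. ring.
Qed.

Lemma bsum_scal (N : nat) (k : C) (w : nat -> nat -> C) :
  bsum N (fun i j => k * w i j) = k * bsum N w.
Proof.
  revert w. induction N as [|N IH]; intros w; simpl; [reflexivity|].
  rewrite <- IH. apply bsum_ext. intros. ring.
Qed.

(** Both sides are the trinomial sum over [k + i + l = N]; Pascal's rule raises each of the three
    indices in turn, so the induction runs without multinomial coefficients. *)
Lemma bsum_assoc (N : nat) (w : nat -> nat -> nat -> C) :
  bsum N (fun j l => bsum j (fun k i => w k i l)) =
  bsum N (fun k r => bsum r (fun i l => w k i l)).
Proof.
  revert w. induction N as [|N IH]; intros w; simpl; [reflexivity|].
  transitivity (bsum N (fun j l => bsum j (fun k i => w (S k) i l + w k (S i) l + w k i (S l)))).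
  { apply bsum_ext. intros j l _. now rewrite <- bsum_plus. }
  rewrite (IH (fun k i l => w (S k) i l + w k (S i) l + w k i (S l))).
  apply bsum_ext. intros k r _. rewrite <- bsum_plus. apply bsum_ext. intros. ring.
Qed.

(** Absorption [j binom(N+1, j) = (N+1) binom(N, j-1)]; at [j = 0] the value of [pred] is harmless
    because the factor [# j] vanishes. *)
Lemma bsum_absorb (N : nat) (w : nat -> nat -> C) :
  bsum (S N) (fun i j => # j * w i (pred j)) = # (S N) * bsum N w.
Proof.
  revert w. induction N as [|N IH]; intros w.
  - simpl. ring.
  - change (bsum (S N) (fun i j => # j * w (S i) (pred j) + # (S j) * w i j) =
            # (S (S N)) * bsum (S N) w).
    transitivity (bsum (S N) (fun i j => # j * w (S i) (pred j)) +
                  (bsum (S N) (fun i j => # j * w i (S (pred j))) + bsum (S N) w)).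
    { rewrite <- !bsum_plus. apply bsum_ext. intros i [|j] _; rewrite !nC_S; simpl pred; simpl (# 0); ring. }
    rewrite (IH (fun i j => w (S i) j)), (IH (fun i j => w i (S j))).
    replace (bsum (S N) w) with (bsum N (fun i j => w (S i) j) + bsum N (fun i j => w i (S j)))
      by (simpl; now rewrite <- bsum_plus).
    rewrite (nC_S (S N)). ring.
Qed.

(** Peeling off the first factor shifts [a] or [b] by one, and either way the sum of the parameters
    becomes [a + b + 1]. *)
Lemma bsum_vandermonde (N : nat) (a b : C) :
  bsum N (fun i j => poch a i * poch b j) = poch (a + b) N.
Proof.
  revert a b. induction N as [|N IH]; intros a b.
  - simpl. ring.
  - change (bsum N (fun i j => poch a (S i) * poch b j + poch a i * poch b (S j)) = poch (a + b) (S N)).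
    rewrite (bsum_ext _ _ (fun i j => a * (poch (a + 1) i * poch b j) + b * (poch a i * poch (b + 1) j)))
      by (intros; rewrite !poch_Sl; ring).
    rewrite bsum_plus, !bsum_scal, !IH, poch_Sl.
    replace (a + 1 + b) with (a + b + 1) by ring.
    replace (a + (b + 1)) with (a + b + 1) by ring. ring.
Qed.

(** Term of the balanced series 3F2(-N, A, B; c, 1-D-N; 1) multiplied by [(c)_N (D)_N], without its
    binomial coefficient. [D] is a separate argument so that the balance condition stays an equation
    when the parameters are shifted. *)
Definition saal_term (A B D : C) (c : C) (i j : nat) : C :=
  poch D j * poch A i * poch B i * poch (c + # i) j.

(** Expanding level [N + 2] by Pascal's rule produces a level [N + 1] sum in which [c] but not [D]
    is shifted. That sum is not balanced, and its reduction to balanced ones involves levels [N + 1]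
    and [N]; hence the two-step induction. *)
Lemma pfaff_saalschutz (N : nat) : forall A B c D : C, D = c - A - B ->
  bsum N (saal_term A B D c) = poch (c - A) N * poch (c - B) N.
Proof.
  assert (two : forall N,
    (forall A B c D : C, D = c - A - B ->
       bsum N (saal_term A B D c) = poch (c - A) N * poch (c - B) N) /\
    (forall A B c D : C, D = c - A - B ->
       bsum (S N) (saal_term A B D c) = poch (c - A) (S N) * poch (c - B) (S N))).
  2: apply two.
  clear N. induction N as [|N [IH0 IH1]].
  - split; intros A B c D ->; unfold saal_term; simpl; ring.
  - split; [exact IH1|]. intros A B c D HD.
    pose (R := bsum (S N) (fun i j => poch D j * poch A i * poch B i * poch (c + 1 + # i) j)).
    (* [(c+1+i)_j = (c+i)_j + j (c+1+i)_(j-1)] and [(D)_j = D (D+1)_(j-1)]; the factor [j] is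
       absorbed by the binomial coefficient. *)
    assert (HR : R = bsum (S N) (saal_term A B D c) +
                     # (S N) * (D * bsum N (saal_term A B (D + 1) (c + 1)))).
    { rewrite <- bsum_scal, <- bsum_absorb, <- bsum_plus.
      apply bsum_ext. intros i [|j] _; unfold saal_term; simpl pred.
      - simpl. ring.
      - rewrite (poch_Sl (c + # i)), (poch_Sl D). replace (c + # i + 1) with (c + 1 + # i) by ring.
        simpl (poch (c + 1 + # i) (S j)). rewrite nC_S. ring. }
    (* With [D = c-A-B] one has [(A+i)(B+i) + (D+j)(c+i) = (c-A)(c-B) + (i+j)(c+i)], and [i + j] is
       constant on the sum. *)
    assert (HS : bsum (S (S N)) (saal_term A B D c) =
       (c - A) * (c - B) * R + # (S N) * (c + # (S N)) * bsum (S N) (saal_term A B D c)).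
    { unfold R. rewrite <- !bsum_scal, <- bsum_plus.
      change (bsum (S (S N)) (saal_term A B D c)) with
        (bsum (S N) (fun i j => saal_term A B D c (S i) j + saal_term A B D c i (S j))).
      apply bsum_ext. intros i j Hij. rewrite <- Hij. unfold saal_term.
      assert (E : poch (c + # i) j * (c + # i + # j) = (c + # i) * poch (c + 1 + # i) j).
      { replace (c + 1 + # i) with (c + # i + 1) by ring. now rewrite <- poch_Sl. }
      rewrite (poch_Sl (c + # i)). replace (c + # i + 1) with (c + 1 + # i) by ring.
      replace (c + # (S i)) with (c + 1 + # i) by (rewrite nC_S; ring).
      rewrite nC_add. simpl (poch _ (S _)).
      transitivity (poch D j * poch A i * poch B i * poch (c + 1 + # i) j * ((c - A) * (c - B)) +
         (# i + # j) * (poch D j * poch A i * poch B i * ((c + # i) * poch (c + 1 + # i) j))).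
      - subst D. ring.
      - rewrite <- E. ring. }
    rewrite HS, HR, IH1 by exact HD.
    rewrite IH0 by (subst D; ring).
    rewrite !(poch_Sl _ (S N)).
    replace (c + 1 - A) with (c - A + 1) by ring. replace (c + 1 - B) with (c - B + 1) by ring.
    change (poch (c - A + 1) (S N)) with (poch (c - A + 1) N * (c - A + 1 + # N)).
    change (poch (c - B + 1) (S N)) with (poch (c - B + 1) N * (c - B + 1 + # N)).
    rewrite !(poch_Sl _ N), nC_S. subst D. ring.
Qed.

(* Here [Q] stands for a polynomial of degree at most [d]; the sum is then a finite difference. *)
Definition annihilated (d : nat) (Q : nat -> C) : Prop :=
  forall (M k : nat) (b : C), (d <= M < k)%nat ->
    bsum k (fun i j => poch b i * Q i * poch (- b - # M) j) = 0.

Lemma annihilated_const (q : C) : annihilated 0 (fun _ => q).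
Proof.
  intros M k b [_ H].
  rewrite (bsum_ext _ _ (fun i j => q * (poch b i * poch (- b - # M) j))) by (intros; ring).
  rewrite bsum_scal, bsum_vandermonde.
  replace (b + (- b - # M)) with (- # M) by ring. rewrite poch_neg_nat by exact H. ring.
Qed.

(** [(f+i) (b)_i = b (b+1)_i + (f-b) (b)_i]. The first part is an instance with [b] raised and [M]
    lowered by one, which is why [annihilated] quantifies over all [b] and all [M >= d]. *)
Lemma annihilated_linear (d : nat) (Q : nat -> C) (f : C) :
  annihilated d Q -> annihilated (S d) (fun n => (f + # n) * Q n).
Proof.
  intros HQ [|M] k b H; [lia|].
  rewrite (bsum_ext _ _ (fun i j => b * (poch (b + 1) i * Q i * poch (- (b + 1) - # M) j) +
      (f - b) * (poch b i * Q i * poch (- b - # (S M)) j))).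
  - rewrite bsum_plus, !bsum_scal, !HQ by lia. ring.
  - intros i j _. replace (- (b + 1) - # M) with (- b - # (S M)) by (rewrite nC_S; ring).
    replace (b * (poch (b + 1) i * Q i * poch (- b - # (S M)) j))
      with (b * poch (b + 1) i * (Q i * poch (- b - # (S M)) j)) by ring.
    rewrite <- poch_Sl. simpl. ring.
Qed.

Lemma annihilated_ext (d : nat) (Q Q' : nat -> C) :
  (forall n, Q n = Q' n) -> annihilated d Q -> annihilated d Q'.
Proof.
  intros E H M k b Hk. rewrite <- (H M k b Hk). apply bsum_ext. intros. now rewrite E.
Qed.

Lemma annihilated_scal (d : nat) (Q : nat -> C) (q : C) :
  annihilated d Q -> annihilated d (fun n => q * Q n).
Proof.
  intros H M k b Hk.
  rewrite (bsum_ext _ _ (fun i j => q * (poch b i * Q i * poch (- b - # M) j))) by (intros; ring).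
  rewrite bsum_scal, H by exact Hk. ring.
Qed.

Lemma annihilated_poch (d k : nat) (Q : nat -> C) (f : C) :
  annihilated d Q -> annihilated (k + d) (fun n => poch (f + # n) k * Q n).
Proof.
  intros HQ. induction k as [|k IH].
  - apply annihilated_ext with (2 := HQ). intros. simpl. ring.
  - apply annihilated_ext with (2 := annihilated_linear _ _ (f + # k) IH).
    intros n. simpl. ring.
Qed.

Definition shifted (fs : list C) (ms : list nat) : list C :=
  map (fun p => fst p + # (snd p)) (combine fs ms).

Definition poch_prod (A : list C) (n : nat) : C := prodC (map (fun a => poch a n) A).

Lemma poch_prod_neq_0 (A : list C) (n : nat) :
  (forall f, In f A -> not_nonpos_int f) -> poch_prod A n <> 0.
Proof.
  intros H. unfold poch_prod, prodC. induction A as [|f A IH]; simpl.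
  - apply C1_nz.
  - apply Cmult_neq_0; [apply poch_neq_0, H; now left|]. apply IH. intros g Hg. apply H. now right.
Qed.

(** [(f+m)_n / (f)_n = (f+n)_m / (f)_m] turns each ratio into a polynomial of degree [m] in [n],
    whose linear factors are added one at a time. *)
Lemma annihilated_shift_ratio (fs : list C) (ms : list nat) :
  length ms = length fs -> (forall f, In f fs -> not_nonpos_int f) ->
  annihilated (list_sum ms) (fun n => poch_prod (shifted fs ms) n / poch_prod fs n).
Proof.
  revert ms. induction fs as [|f fs IH]; intros [|m ms] Hl Hf; try discriminate.
  - apply annihilated_ext with (2 := annihilated_const 1). intros. unfold poch_prod, shifted. simpl.
    field.
  - simpl list_sum.
    assert (Hf' : forall g, In g fs -> not_nonpos_int g) by (intros g Hg; apply Hf; now right).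
    assert (Hfn : forall n, poch f n <> 0) by (intros n; apply poch_neq_0, Hf; now left).
    apply annihilated_ext with
      (2 := annihilated_scal _ _ (/ poch f m)
         (annihilated_poch _ m _ f (IH ms (eq_add_S _ _ Hl) Hf'))).
    intros n. pose proof (poch_prod_neq_0 fs n Hf') as Hn.
    change (poch_prod (shifted (f :: fs) (m :: ms)) n)
      with (poch (f + # m) n * poch_prod (shifted fs ms) n).
    change (poch_prod (f :: fs) n) with (poch f n * poch_prod fs n).
    replace (poch (f + # m) n) with (poch f n * poch (f + # n) m / poch f m).
    + field. repeat split; auto.
    + rewrite poch_shift. field. auto.
Qed.

(** * The coefficient identity *)

Lemma sumC_ext (N : nat) (u v : nat -> C) :
  (forall k, (k <= N)%nat -> u k = v k) -> sumC N u = sumC N v.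
Proof.
  induction N as [|N IH]; intros H; simpl.
  - now apply H.
  - rewrite IH, H; auto.
Qed.

Lemma sumC_plus (N : nat) (u v : nat -> C) :
  sumC N (fun k => u k + v k) = sumC N u + sumC N v.
Proof. induction N as [|N IH]; simpl; [|rewrite IH]; ring. Qed.

Lemma sumC_scal (N : nat) (q : C) (u : nat -> C) :
  sumC N (fun k => q * u k) = q * sumC N u.
Proof. induction N as [|N IH]; simpl; [|rewrite IH]; ring. Qed.

Lemma sumC_Sl (N : nat) (u : nat -> C) :
  sumC (S N) u = u O + sumC N (fun k => u (S k)).
Proof.
  induction N as [|N IH]; [reflexivity|].
  change (sumC (S N) u + u (S (S N)) = u O + (sumC N (fun k => u (S k)) + u (S (S N)))).
  rewrite IH. ring.
Qed.

Lemma sumC_zero_tail (n N : nat) (u : nat -> C) : (n <= N)%nat ->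
  (forall k, (n < k <= N)%nat -> u k = 0) -> sumC N u = sumC n u.
Proof.
  intros H. induction H as [|N H IH]; intros Hu; [reflexivity|].
  simpl. rewrite IH, Hu by (intros; try apply Hu; lia). ring.
Qed.

Lemma fact_neq_0_C (n : nat) : # (fact n) <> 0.
Proof. apply nC_neq_0, fact_neq_0. Qed.

Lemma fact_S_C (n : nat) : # (fact (S n)) = # (S n) * # (fact n).
Proof. now rewrite fact_simpl, mult_INR, RtoC_mult. Qed.

(** Pascal's rule: with [N + 1 = k + (N + 1 - k)] in front of the summand of level [N + 1], each
    part cancels a factor of one of the two factorials. *)
Lemma bsum_sumC (N : nat) (w : nat -> nat -> C) :
  bsum N w = # (fact N) * sumC N (fun k => w k (N - k)%nat / (# (fact k) * # (fact (N - k)))).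
Proof.
  revert w. induction N as [|N IH]; intros w.
  - simpl. field.
  - change (bsum (S N) w) with (bsum N (fun i j => w (S i) j + w i (S j))).
    rewrite IH, fact_S_C.
    transitivity (# (fact N) * (
      sumC (S N) (fun k => # k * (w k (S N - k)%nat / (# (fact k) * # (fact (S N - k))))) +
      sumC (S N) (fun k => # (S N - k) * (w k (S N - k)%nat / (# (fact k) * # (fact (S N - k))))))).
    + f_equal. rewrite sumC_Sl.
      change (sumC (S N) (fun k => # (S N - k) * (w k (S N - k)%nat / (# (fact k) * # (fact (S N - k))))))
        with (sumC N (fun k => # (S N - k) * (w k (S N - k)%nat / (# (fact k) * # (fact (S N - k)))))
              + # (S N - S N) * (w (S N) (S N - S N)%nat / (# (fact (S N)) * # (fact (S N - S N))))).
      rewrite Nat.sub_diag. simpl (# 0). rewrite !Cmult_0_l, Cplus_0_l, Cplus_0_r, <- sumC_plus.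
      apply sumC_ext. intros k Hk. rewrite Nat.sub_succ, (Nat.sub_succ_l k N) by exact Hk.
      rewrite !fact_S_C. field.
      repeat split; (apply fact_neq_0_C || apply nC_neq_0; lia).
    + rewrite <- sumC_plus, (Cmult_comm (# (S N))), <- Cmult_assoc, <- (sumC_scal _ (# (S N))).
      f_equal. apply sumC_ext. intros k Hk.
      rewrite <- Cmult_plus_distr_r, <- nC_add. do 3 f_equal. lia.
Qed.

(** [poch 0 r] is 1 at [r = 0] and 0 otherwise, the unit of binomial convolution; it appears when
    two opposite exponents cancel. *)
Lemma bsum_poch_0 (N : nat) (u : nat -> C) :
  bsum N (fun i r => u i * poch 0 r) = u N.
Proof.
  revert u. induction N as [|N IH]; intros u.
  - simpl. ring.
  - transitivity (bsum N (fun i r => u (S i) * poch 0 r)); [|apply (IH (fun i => u (S i)))].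
    apply (bsum_ext N). intros i r _. rewrite poch_Sl. ring.
Qed.

(** Divided by [k!], these are the coefficients of [(1-x)^(b+m)] times the series of
    [(b)_n Q(n) x^n / n!]; that product is a polynomial of degree at most [m] when [Q] has degree at
    most [m]. *)
Definition binom_diff (b : C) (m : nat) (Q : nat -> C) (k : nat) : C :=
  bsum k (fun i j => poch b i * Q i * poch (- b - # m) j).

(** Multiplication by [(1-x)^(-b-m)] undoes the transform: after reassociation, Vandermonde's sum
    combines the two exponents to 0. *)
Lemma binom_diff_inverse (b : C) (m : nat) (Q : nat -> C) (n : nat) :
  bsum n (fun k l => binom_diff b m Q k * poch (b + # m) l) = poch b n * Q n.
Proof.
  rewrite <- (bsum_poch_0 n (fun i => poch b i * Q i)).
  transitivity (bsum n (fun k l => bsum k (fun i j =>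
    poch b i * Q i * (poch (- b - # m) j * poch (b + # m) l)))).
  - apply bsum_ext. intros k l _. unfold binom_diff. rewrite Cmult_comm, <- bsum_scal.
    apply bsum_ext. intros. ring.
  - rewrite (bsum_assoc n (fun i j l => poch b i * Q i * (poch (- b - # m) j * poch (b + # m) l))).
    apply bsum_ext. intros i r _. rewrite bsum_scal, bsum_vandermonde.
    replace (- b - # m + (b + # m)) with (RtoC 0) by ring. reflexivity.
Qed.

(** Divided by [(c)_n n!], this is the coefficient of [x^n] in the sum over [k] of [G_k (a)_k /
    ((c)_k k!) x^k 2F1(c-a, c-b-m+k; c+k; x)], where [G_k] is [binom_diff b m Q k]. *)
Definition transf_coeff (a b c : C) (m : nat) (Q : nat -> C) (n : nat) : C :=
  bsum n (fun k i => binom_diff b m Q k * poch a k * (poch (c - a) i * poch (c - b - # m + # k) i)).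

(** This is multiplication by [(1-x)^(c-a-b-m)]. After reassociation the inner sum is of
    Pfaff-Saalschuetz type with upper parameters [c-a], [c-b-m+k] and lower parameter [c+k]; its
    balance [a+b+m-c] does not depend on [k], so one power of [1-x] serves every [k]. *)
Lemma transf_coeff_convolution (a b c : C) (m : nat) (Q : nat -> C) (n : nat) :
  bsum n (fun j l => poch (a + b + # m - c) l * transf_coeff a b c m Q j * poch (c + # j) l) =
  poch a n * poch b n * Q n.
Proof.
  rewrite (Cmult_comm (poch a n)), <- Cmult_assoc, (Cmult_comm (poch a n)), Cmult_assoc.
  rewrite <- (binom_diff_inverse b m).
  transitivity (bsum n (fun j l => bsum j (fun k i => binom_diff b m Q k * poch a k *
     saal_term (c - a) (c - b - # m + # k) (a + b + # m - c) (c + # k) i l))).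
  - apply bsum_ext. intros j l _. unfold transf_coeff.
    replace (poch (a + b + # m - c) l *
        bsum j (fun k i => binom_diff b m Q k * poch a k * (poch (c - a) i * poch (c - b - # m + # k) i)) *
        poch (c + # j) l)
      with (poch (a + b + # m - c) l * poch (c + # j) l *
        bsum j (fun k i => binom_diff b m Q k * poch a k * (poch (c - a) i * poch (c - b - # m + # k) i)))
      by ring.
    rewrite <- bsum_scal. apply bsum_ext. intros k i Hj. unfold saal_term.
    replace (c + # j) with (c + # k + # i) by (rewrite <- Hj, nC_add; ring). ring.
  - rewrite (bsum_assoc n (fun k i l => binom_diff b m Q k * poch a k *
      saal_term (c - a) (c - b - # m + # k) (a + b + # m - c) (c + # k) i l)).
    rewrite Cmult_comm, <- bsum_scal. apply bsum_ext. intros k r Hn.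
    rewrite bsum_scal, pfaff_saalschutz by ring.
    replace (c + # k - (c - a)) with (a + # k) by ring.
    replace (c + # k - (c - b - # m + # k)) with (b + # m) by ring.
    rewrite <- Hn, poch_add. ring.
Qed.

(** * Evaluation of [Phat] at [-n] *)

Lemma sign_square (n : nat) : (- (1)) ^ n * (- (1)) ^ n = 1.
Proof. rewrite <- Cpow_mult_l. replace (- (1) * - (1)) with (RtoC 1) by ring. apply Cpow_1_l. Qed.

Lemma poch_reflect (x : C) (k : nat) : poch x k = (- (1)) ^ k * poch (1 - x - # k) k.
Proof.
  induction k as [|k IH].
  - simpl. ring.
  - rewrite (poch_Sl (1 - x - # (S k))), nC_S, Cpow_S. simpl poch. rewrite IH.
    replace (1 - x - (# k + 1) + 1) with (1 - x - # k) by ring. ring.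
Qed.

Lemma poch_neg_fact (n k : nat) : (k <= n)%nat ->
  poch (- # n) k * # (fact (n - k)) = (- (1)) ^ k * # (fact n).
Proof.
  induction k as [|k IH]; intros H.
  - rewrite Nat.sub_0_r. simpl. ring.
  - simpl poch. rewrite Cpow_S.
    replace (- (1) * (- (1)) ^ k * # (fact n)) with (- (1) * ((- (1)) ^ k * # (fact n))) by ring.
    rewrite <- IH by lia. replace (n - k)%nat with (S (n - S k)) by lia.
    rewrite fact_S_C. replace (- # n + # k) with (- # (S (n - S k))); [ring|].
    replace (# n) with (# (S (n - S k) + k)) by (do 2 f_equal; lia). rewrite nC_add. ring.
Qed.

(** [(-b-m)_k = (-1)^j (b+m-k+1)_j (-b-m)_(k-j)] explains the lower parameter [b+m-k+1], and
    [(-k)_j / j!] is a signed binomial coefficient; the signs cancel. *)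
Lemma hyp_at1_binom_diff (b : C) (fs : list C) (ms : list nat) (k : nat) :
  let m := list_sum ms in
  (forall f, In f fs -> not_nonpos_int f) ->
  (forall n, (n <= k)%nat -> poch (b + # m - # k + 1) n <> 0) ->
  poch (- b - # m) k *
    hyp_at1_terminating ((- # k) :: b :: shifted fs ms) ((b + # m - # k + 1) :: fs) k =
  binom_diff b m (fun n => poch_prod (shifted fs ms) n / poch_prod fs n) k.
Proof.
  intros m Hf Hb. unfold hyp_at1_terminating, binom_diff.
  rewrite bsum_sumC, <- !sumC_scal. apply sumC_ext. intros j Hj. unfold hyp_term.
  simpl map. unfold prodC. simpl fold_right. fold (prodC (map (fun a => poch a j) (shifted fs ms))).
  fold (prodC (map (fun a => poch a j) fs)).
  fold (poch_prod (shifted fs ms) j). fold (poch_prod fs j).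
  pose proof (poch_prod_neq_0 fs j Hf) as Hfs. pose proof (Hb j Hj) as Hbj.
  rewrite Cpow_1_l.
  assert (E1 : poch (- b - # m) k =
    (- (1)) ^ k * (poch (b + # m - # k + 1) j * ((- (1)) ^ (k - j) * poch (- b - # m) (k - j)))).
  { rewrite (poch_reflect (- b - # m)). f_equal.
    replace (1 - (- b - # m) - # k) with (b + # m - # k + 1) by ring.
    replace k with (j + (k - j))%nat at 2 by lia. rewrite poch_add. f_equal.
    rewrite poch_reflect. do 2 f_equal.
    replace (# k) with (# (j + (k - j))) by (do 2 f_equal; lia). rewrite !nC_add. ring. }
  assert (E2 : poch (- # k) j = (- (1)) ^ j * # (fact k) / # (fact (k - j))).
  { rewrite <- poch_neg_fact by exact Hj. field. apply fact_neq_0_C. }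
  assert (E3 : (- (1)) ^ k * (- (1)) ^ (k - j) * (- (1)) ^ j = 1).
  { rewrite <- Cmult_assoc, <- Cpow_add_r. replace (k - j + j)%nat with k by lia. apply sign_square. }
  rewrite E1, E2.
  transitivity ((- (1)) ^ k * (- (1)) ^ (k - j) * (- (1)) ^ j * (# (fact k) * poch (- b - # m) (k - j) *
     poch b j * poch_prod (shifted fs ms) j / (poch_prod fs j * # (fact j) * # (fact (k - j))))).
  - field. repeat split; auto using fact_neq_0_C.
  - rewrite E3. field. repeat split; auto using fact_neq_0_C.
Qed.

(** At [t = -n] the factor [(t)_k] becomes [(-1)^k n! / (n-k)!], which together with the [k!] in the
    denominator supplies the binomial weights. *)
Lemma Phat_neg_nat (fs : list C) (ms : list nat) (a b c : C) (n : nat) :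
  let m := list_sum ms in
  length ms = length fs ->
  poch (c - a - # m) m <> 0 -> poch (c - b - # m) m <> 0 ->
  (forall f, In f fs -> not_nonpos_int f) ->
  (forall k, (k <= m)%nat -> forall n, (n <= k)%nat -> poch (b + # m - # k + 1) n <> 0) ->
  poch (c - a - # m) n * poch (c - b - # m) n * Phat fs ms a b c (- # n) =
  transf_coeff a b c m (fun n => poch_prod (shifted fs ms) n / poch_prod fs n) n.
Proof.
  intros m Hl Ha Hc Hf Hb. unfold transf_coeff. rewrite bsum_sumC.
  unfold Phat. fold m. fold (shifted fs ms). rewrite <- !sumC_scal.
  set (Q := fun n => poch_prod (shifted fs ms) n / poch_prod fs n).
  assert (HQ : annihilated m Q) by now apply annihilated_shift_ratio.
  (* Both sums are cut at [min n m]: on the left [(-n)_k] vanishes for [k > n], on the right the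
     binomial transform vanishes for [k > m]. *)
  rewrite (sumC_zero_tail (min n m) m); [|lia|].
  2:{ intros k Hk. rewrite (poch_neg_nat n k) by lia. unfold Cdiv. ring. }
  rewrite (sumC_zero_tail (min n m) n); [|lia|].
  2:{ intros k Hk. unfold binom_diff. rewrite (HQ m k b) by lia. unfold Cdiv. ring. }
  apply sumC_ext. intros k Hk.
  assert (HG := hyp_at1_binom_diff b fs ms k Hf (Hb k ltac:(lia))). cbv zeta in HG.
  fold m Q in HG. rewrite <- HG. set (H := hyp_at1_terminating _ _ k).
  (* Both sides equal [(c-a-m)_(n+m-k)]. *)
  assert (F1 : poch (c - a - # m) n * poch (c - a - # m - - # n) (m - k) =
               poch (c - a - # m) m * poch (c - a) (n - k)).
  { replace (c - a - # m - - # n) with (c - a - # m + # n) by ring.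
    replace (c - a) with (c - a - # m + # m) at 4 by ring.
    rewrite <- !poch_add. f_equal. lia. }
  assert (F2 : poch (c - b - # m) n = poch (c - b - # m) k * poch (c - b - # m + # k) (n - k)).
  { rewrite <- poch_add. f_equal. lia. }
  assert (F3 : poch (- # n) k = (- (1)) ^ k * # (fact n) / # (fact (n - k))).
  { rewrite <- poch_neg_fact by lia. field. apply fact_neq_0_C. }
  assert (HB : poch (c - b - # m) k <> 0) by (apply poch_neq_0_le with m; [lia|exact Hc]).
  transitivity (((- (1)) ^ k * (- (1)) ^ k) * (poch (c - a - # m) n * poch (c - a - # m - - # n) (m - k)) *
     (poch a k * poch (- b - # m) k * # (fact n) * poch (c - b - # m + # k) (n - k) * H) /
     (poch (c - a - # m) m * # (fact k) * # (fact (n - k)))).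
  - replace (RtoC (-1)) with (- RtoC 1) by (rewrite <- RtoC_opp; reflexivity).
    rewrite F2, F3. field. repeat split; auto using fact_neq_0_C.
  - rewrite F1, sign_square. field. repeat split; auto using fact_neq_0_C.
Qed.

(** * Complex derivatives *)

Definition nearC (z : C) (P : C -> Prop) : Prop :=
  exists delta : R, (0 < delta)%R /\ forall w, (Cmod (w - z) < delta)%R -> P w.

Lemma nearC_and (z : C) (P Q : C -> Prop) :
  nearC z P -> nearC z Q -> nearC z (fun w => P w /\ Q w).
Proof.
  intros [d [Hd HP]] [e [He HQ]]. exists (Rmin d e). split.
  - now apply Rmin_glb_lt.
  - intros w Hw. pose proof (Rmin_l d e). pose proof (Rmin_r d e).
    split; [apply HP|apply HQ]; lra.
Qed.

Lemma nearC_imp (z : C) (P Q : C -> Prop) :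
  (forall w, P w -> Q w) -> nearC z P -> nearC z Q.
Proof. intros H [d [Hd HP]]. exists d. auto. Qed.

Lemma nearC_self (z : C) (P : C -> Prop) : nearC z P -> P z.
Proof.
  intros [d [Hd HP]]. apply HP. replace (z - z) with (RtoC 0) by ring. now rewrite Cmod_0.
Qed.

Definition contC (f : C -> C) (z : C) : Prop :=
  forall eps : R, (0 < eps)%R -> nearC z (fun w => (Cmod (f w - f z) < eps)%R).

Definition littleo (z : C) (r : C -> C) : Prop :=
  forall eps : R, (0 < eps)%R -> nearC z (fun w => (Cmod (r w) <= eps * Cmod (w - z))%R).

(** Differentiability as an estimate of the remainder in [Cmod], so that the rules of calculus
    become ring identities between remainders. *)
Definition cderiv (f : C -> C) (z l : C) : Prop :=
  littleo z (fun w => f w - f z - l * (w - z)).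

Lemma littleo_ext (z : C) (r s : C -> C) :
  nearC z (fun w => r w = s w) -> littleo z r -> littleo z s.
Proof.
  intros H Hr eps He. generalize (nearC_and _ _ _ H (Hr eps He)). apply nearC_imp.
  intros w [E Hw]. now rewrite <- E.
Qed.

Lemma littleo_plus (z : C) (r s : C -> C) :
  littleo z r -> littleo z s -> littleo z (fun w => r w + s w).
Proof.
  intros Hr Hs eps He.
  generalize (nearC_and _ _ _ (Hr (eps / 2)%R ltac:(lra)) (Hs (eps / 2)%R ltac:(lra))).
  apply nearC_imp. intros w [H1 H2]. pose proof (Cmod_triangle (r w) (s w)). lra.
Qed.

Lemma littleo_mult_bounded (z : C) (r s : C -> C) (M : R) :
  littleo z r -> nearC z (fun w => (Cmod (s w) <= M)%R) -> littleo z (fun w => r w * s w).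
Proof.
  intros Hr Hs eps He.
  assert (HM : (0 <= M)%R) by (pose proof (nearC_self _ _ Hs); pose proof (Cmod_ge_0 (s z)); lra).
  assert (He' : (0 < eps / (M + 1))%R) by (apply Rdiv_lt_0_compat; lra).
  generalize (nearC_and _ _ _ (Hr _ He') Hs). apply nearC_imp. intros w [H1 H2].
  rewrite Cmod_mult. pose proof (Cmod_ge_0 (r w)). pose proof (Cmod_ge_0 (s w)).
  pose proof (Cmod_ge_0 (w - z)).
  apply Rle_trans with (eps / (M + 1) * Cmod (w - z) * (M + 1))%R.
  - apply Rmult_le_compat; lra.
  - right. field. lra.
Qed.

Lemma littleo_mult_vanishing (z : C) (r s : C -> C) (M : R) :
  nearC z (fun w => (Cmod (r w) <= M * Cmod (w - z))%R) ->
  (forall eps : R, (0 < eps)%R -> nearC z (fun w => (Cmod (s w) < eps)%R)) ->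
  littleo z (fun w => r w * s w).
Proof.
  intros Hr Hs eps He.
  assert (HM : (0 < Rabs M + 1)%R) by (pose proof (Rabs_pos M); lra).
  assert (He' : (0 < eps / (Rabs M + 1))%R) by (apply Rdiv_lt_0_compat; lra).
  generalize (nearC_and _ _ _ Hr (Hs _ He')). apply nearC_imp. intros w [H1 H2].
  rewrite Cmod_mult. pose proof (Cmod_ge_0 (r w)). pose proof (Cmod_ge_0 (s w)).
  pose proof (Cmod_ge_0 (w - z)). pose proof (Rle_abs M).
  apply Rle_trans with ((Rabs M + 1) * Cmod (w - z) * (eps / (Rabs M + 1)))%R.
  - apply Rmult_le_compat; try lra. nra.
  - right. field. lra.
Qed.

Lemma cderiv_lipschitz (f : C -> C) (z l : C) : cderiv f z l ->
  nearC z (fun w => (Cmod (f w - f z) <= (Cmod l + 1) * Cmod (w - z))%R).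
Proof.
  intros H. generalize (H 1%R Rlt_0_1). apply nearC_imp. intros w Hw.
  replace (f w - f z) with ((f w - f z - l * (w - z)) + l * (w - z)) by ring.
  eapply Rle_trans; [apply Cmod_triangle|]. rewrite Cmod_mult. lra.
Qed.

Lemma cderiv_contC (f : C -> C) (z l : C) : cderiv f z l -> contC f z.
Proof.
  intros H eps He. pose proof (Cmod_ge_0 l) as Hl.
  assert (Hd : (0 < eps / (Cmod l + 1))%R) by (apply Rdiv_lt_0_compat; lra).
  assert (H0 : nearC z (fun w => (Cmod (w - z) < eps / (Cmod l + 1))%R))
    by (exists (eps / (Cmod l + 1))%R; auto).
  generalize (nearC_and _ _ _ (cderiv_lipschitz _ _ _ H) H0). apply nearC_imp.
  intros w [H1 H2]. eapply Rle_lt_trans; [exact H1|].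
  replace eps with ((Cmod l + 1) * (eps / (Cmod l + 1)))%R by (field; lra).
  apply Rmult_lt_compat_l; lra.
Qed.

Lemma contC_nearC (f : C -> C) (z : C) (P : C -> Prop) :
  contC f z -> nearC (f z) P -> nearC z (fun w => P (f w)).
Proof. intros Hf [d [Hd HP]]. generalize (Hf d Hd). apply nearC_imp. auto. Qed.

Lemma contC_bounded (f : C -> C) (z : C) :
  contC f z -> nearC z (fun w => (Cmod (f w) <= Cmod (f z) + 1)%R).
Proof.
  intros H. generalize (H 1%R Rlt_0_1). apply nearC_imp. intros w Hw.
  replace (f w) with ((f w - f z) + f z) by ring.
  eapply Rle_trans; [apply Cmod_triangle|]. lra.
Qed.

Lemma cderiv_ext_loc (f g : C -> C) (z l : C) :
  nearC z (fun w => f w = g w) -> cderiv f z l -> cderiv g z l.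
Proof.
  intros E. apply littleo_ext. pose proof (nearC_self _ _ E) as E0. revert E. apply nearC_imp.
  intros w Ew. now rewrite Ew, E0.
Qed.

Lemma cderiv_const (q z : C) : cderiv (fun _ => q) z 0.
Proof.
  intros eps He. exists 1%R. split; [lra|]. intros w _.
  replace (q - q - 0 * (w - z)) with (RtoC 0) by ring. rewrite Cmod_0.
  pose proof (Cmod_ge_0 (w - z)). nra.
Qed.

Lemma cderiv_id (z : C) : cderiv (fun w => w) z 1.
Proof.
  intros eps He. exists 1%R. split; [lra|]. intros w _.
  replace (w - z - 1 * (w - z)) with (RtoC 0) by ring. rewrite Cmod_0.
  pose proof (Cmod_ge_0 (w - z)). nra.
Qed.

Lemma nearC_all (z : C) (P : C -> Prop) : (forall w, P w) -> nearC z P.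
Proof. intros H. exists 1%R. split; [lra|auto]. Qed.

Lemma cderiv_plus (f g : C -> C) (z l k : C) :
  cderiv f z l -> cderiv g z k -> cderiv (fun w => f w + g w) z (l + k).
Proof.
  intros Hf Hg. apply littleo_ext with (2 := littleo_plus _ _ _ Hf Hg).
  apply nearC_all. intros w. ring.
Qed.

Lemma cderiv_mult (f g : C -> C) (z l k : C) :
  cderiv f z l -> cderiv g z k -> cderiv (fun w => f w * g w) z (l * g z + f z * k).
Proof.
  intros Hf Hg.
  pose proof (littleo_mult_bounded _ _ g _ Hf (contC_bounded _ _ (cderiv_contC _ _ _ Hg))) as H1.
  assert (H2 : littleo z (fun w => (l * (w - z)) * (g w - g z))).
  { apply littleo_mult_vanishing with (Cmod l).
    - apply nearC_all. intros w. rewrite Cmod_mult. lra.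
    - apply (cderiv_contC _ _ _ Hg). }
  assert (H3 : littleo z (fun w => (g w - g z - k * (w - z)) * f z)).
  { apply littleo_mult_bounded with (Cmod (f z)); [exact Hg|]. apply nearC_all. intros; lra. }
  apply littleo_ext with (2 := littleo_plus _ _ _ (littleo_plus _ _ _ H1 H2) H3).
  apply nearC_all. intros w. ring.
Qed.

Lemma littleo_comp (f : C -> C) (z l : C) (r : C -> C) :
  cderiv f z l -> littleo (f z) r -> littleo z (fun w => r (f w)).
Proof.
  intros Hf Hr eps He. pose proof (Cmod_ge_0 l).
  assert (He' : (0 < eps / (Cmod l + 1))%R) by (apply Rdiv_lt_0_compat; lra).
  generalize (nearC_and _ _ _ (contC_nearC _ _ _ (cderiv_contC _ _ _ Hf) (Hr _ He'))
    (cderiv_lipschitz _ _ _ Hf)).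
  apply nearC_imp. intros w [H1 H2]. eapply Rle_trans; [exact H1|].
  apply Rle_trans with (eps / (Cmod l + 1) * ((Cmod l + 1) * Cmod (w - z)))%R.
  - apply Rmult_le_compat_l; lra.
  - right. field. lra.
Qed.

Lemma cderiv_comp (g f : C -> C) (z l k : C) :
  cderiv f z l -> cderiv g (f z) k -> cderiv (fun w => g (f w)) z (k * l).
Proof.
  intros Hf Hg.
  assert (H2 : littleo z (fun w => (f w - f z - l * (w - z)) * k)).
  { apply littleo_mult_bounded with (Cmod k); [exact Hf|]. apply nearC_all. intros; lra. }
  apply littleo_ext with (2 := littleo_plus _ _ _ (littleo_comp _ _ _ _ Hf Hg) H2).
  apply nearC_all. intros w. simpl. ring.
Qed.

Lemma cderiv_scal (f : C -> C) (q z l : C) : cderiv f z l -> cderiv (fun w => q * f w) z (q * l).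
Proof.
  intros H. replace (q * l) with (0 * f z + q * l) by ring.
  exact (cderiv_mult _ _ _ _ _ (cderiv_const q z) H).
Qed.

Lemma cderiv_pow (z : C) (n : nat) : cderiv (fun w => w ^ n) z (# n * z ^ pred n).
Proof.
  induction n as [|n IH].
  - simpl. replace (0 * 1) with (RtoC 0) by ring. apply cderiv_const.
  - replace (# (S n) * z ^ pred (S n)) with (1 * z ^ n + z * (# n * z ^ pred n)).
    + exact (cderiv_mult _ _ _ _ _ (cderiv_id z) IH).
    + rewrite nC_S. destruct n; simpl; ring.
Qed.

Lemma nearC_neq (z p : C) : z <> p -> nearC z (fun w => w <> p).
Proof.
  intros H. exists (Cmod (p - z)). split.
  - apply Cmod_gt_0. intros E. apply H. replace p with (p - z + z) by ring. rewrite E. ring.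
  - intros w Hw ->. lra.
Qed.

Lemma contC_inv (z : C) : z <> 0 -> contC Cinv z.
Proof.
  intros Hz eps He. pose proof (proj1 (Cmod_gt_0 z) Hz) as Hz'.
  (* The first radius keeps [|w|] above [|z|/2], hence [|1/w - 1/z|] is at most
     [2 |w-z| / |z|^2]. *)
  assert (Hd : (0 < Rmin (Cmod z / 2) (eps * (Cmod z * Cmod z) / 2))%R).
  { apply Rmin_glb_lt; [lra|]. assert (0 < Cmod z * Cmod z)%R by nra. nra. }
  exists (Rmin (Cmod z / 2) (eps * (Cmod z * Cmod z) / 2)). split; [exact Hd|]. intros w Hw.
  pose proof (Rmin_l (Cmod z / 2) (eps * (Cmod z * Cmod z) / 2)).
  pose proof (Rmin_r (Cmod z / 2) (eps * (Cmod z * Cmod z) / 2)).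
  assert (Hw2 : (Cmod z / 2 < Cmod w)%R).
  { pose proof (Cmod_triangle w (- (w - z))) as T. rewrite Cmod_opp in T.
    replace (w + - (w - z)) with z in T by ring. lra. }
  assert (Hw0 : w <> 0) by (apply Cmod_gt_0; lra).
  replace (/ w - / z) with (- (w - z) / (w * z)) by (field; auto).
  rewrite Cmod_div by (apply Cmult_neq_0; auto). rewrite Cmod_opp, Cmod_mult.
  apply Rmult_lt_reg_r with (Cmod w * Cmod z)%R; [nra|].
  unfold Rdiv. rewrite Rmult_assoc, Rinv_l by nra.
  assert (Cmod z / 2 * Cmod z < Cmod w * Cmod z)%R by (apply Rmult_lt_compat_r; lra).
  nra.
Qed.

Lemma cderiv_inv (z : C) : z <> 0 -> cderiv Cinv z (- / (z * z)).
Proof.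
  intros Hz.
  assert (H : littleo z (fun w => (- (w - z) / z) * (/ w - / z))).
  { apply littleo_mult_vanishing with (/ Cmod z)%R.
    - apply nearC_all. intros w. rewrite Cmod_div, Cmod_opp by exact Hz. unfold Rdiv. lra.
    - exact (contC_inv z Hz). }
  apply littleo_ext with (2 := H). generalize (nearC_neq z 0 Hz). apply nearC_imp.
  intros w Hw. field. auto.
Qed.

Lemma is_derive_cderiv (f : C -> C) (z l : C) :
  @is_derive C_AbsRing C_NormedModule f z l -> cderiv f z l.
Proof.
  intros [_ H] eps He.
  destruct (H z (fun P HP => HP) (mkposreal eps He)) as [d Hd].
  exists d. split; [apply cond_pos|].
  intros w Hw. specialize (Hd w Hw).
  unfold norm, minus, plus, opp, scal in Hd; simpl in Hd.
  unfold norm, minus, plus, opp, scal in Hd; simpl in Hd.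
  unfold mult in Hd; simpl in Hd.
  rewrite (Cmult_comm l). exact Hd.
Qed.

(** * Exponential, logarithm and principal powers *)

Lemma Cmod_le_abs (z : C) : (Cmod z <= Rabs (Re z) + Rabs (Im z))%R.
Proof.
  replace z with (RtoC (Re z) + Ci * RtoC (Im z)) at 1.
  - eapply Rle_trans; [apply Cmod_triangle|]. rewrite Cmod_mult, Cmod_Ci, !Cmod_R. lra.
  - destruct z as [x y]. unfold Ci, RtoC, Cplus, Cmult, Re, Im; simpl. f_equal; ring.
Qed.

Lemma im_le_Cmod (z : C) : (Rabs (Im z) <= Cmod z)%R.
Proof. eapply Rle_trans; [|apply Rmax_Cmod]. apply Rmax_r. Qed.

Lemma derivable_at_0 (f : R -> R) (l : R) : derivable_pt_lim f 0 l ->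
  forall eps : R, (0 < eps)%R -> exists d : R, (0 < d)%R /\
    forall h : R, (Rabs h < d)%R -> (Rabs (f h - f 0 - l * h) <= eps * Rabs h)%R.
Proof.
  intros H eps He. destruct (H eps He) as [d Hd]. exists d. split; [apply cond_pos|].
  intros h Hh. destruct (Req_dec h 0) as [->|H0].
  - replace (f 0 - f 0 - l * 0)%R with 0%R by ring. rewrite Rabs_R0. lra.
  - specialize (Hd h H0 Hh). rewrite Rplus_0_l in Hd.
    replace (f h - f 0 - l * h)%R with (((f h - f 0) / h - l) * h)%R by (field; exact H0).
    rewrite Rabs_mult. apply Rmult_le_compat_r; [apply Rabs_pos|lra].
Qed.

Lemma Cexp_plus (z w : C) : Cexp (z + w) = Cexp z * Cexp w.
Proof.
  destruct z as [x y], w as [x' y']. unfold Cexp, Cplus, Cmult, Re, Im; simpl.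
  rewrite exp_plus, cos_plus, sin_plus. f_equal; ring.
Qed.

Lemma Cexp_0 : Cexp 0 = 1.
Proof.
  unfold Cexp, RtoC, Re, Im; simpl. rewrite exp_0, cos_0, sin_0. f_equal; ring.
Qed.

(** Only the real derivatives of exp, cos and sin at 0 enter; the addition law later carries the
    estimate to every other point. *)
Lemma littleo_Cexp_0 : littleo 0 (fun w => Cexp w - 1 - w).
Proof.
  intros eps He.
  (* The estimates below add up to [e |x| + 7 e |y|], at most [8 e |w|]. The radius is at most
     [e <= 1], which gives [|x| <= 1]. *)
  set (e := Rmin (eps / 8) 1).
  assert (He1 : (0 < e)%R) by (apply Rmin_glb_lt; lra).
  assert (He2 : (e <= eps / 8)%R) by apply Rmin_l.
  assert (He3 : (e <= 1)%R) by apply Rmin_r.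
  assert (L1 : derivable_pt_lim exp 0 1) by (pose proof (derivable_pt_lim_exp 0) as L; now rewrite exp_0 in L).
  assert (L2 : derivable_pt_lim cos 0 0)
    by (pose proof (derivable_pt_lim_cos 0) as L; now rewrite sin_0, Ropp_0 in L).
  assert (L3 : derivable_pt_lim sin 0 1) by (pose proof (derivable_pt_lim_sin 0) as L; now rewrite cos_0 in L).
  destruct (derivable_at_0 _ _ L1 e He1) as [d1 [Hd1 H1]].
  destruct (derivable_at_0 _ _ L2 e He1) as [d2 [Hd2 H2]].
  destruct (derivable_at_0 _ _ L3 e He1) as [d3 [Hd3 H3]].
  exists (Rmin (Rmin d1 d2) (Rmin d3 e)). split.
  { repeat apply Rmin_glb_lt; lra. }
  intros w Hw. replace (w - 0) with w in * by ring.
  pose proof (Rmin_l (Rmin d1 d2) (Rmin d3 e)). pose proof (Rmin_r (Rmin d1 d2) (Rmin d3 e)).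
  pose proof (Rmin_l d1 d2). pose proof (Rmin_r d1 d2).
  pose proof (Rmin_l d3 e). pose proof (Rmin_r d3 e).
  pose proof (re_le_Cmod w) as Hre. pose proof (im_le_Cmod w) as Him.
  destruct w as [x y]. unfold Re, Im in Hre, Him; simpl in Hre, Him.
  specialize (H1 x ltac:(lra)). specialize (H2 y ltac:(lra)). specialize (H3 y ltac:(lra)).
  rewrite exp_0 in H1. rewrite cos_0 in H2. rewrite sin_0 in H3.
  assert (Hx1 : (Rabs x <= 1)%R) by lra.
  pose proof (Rabs_pos x) as Px. pose proof (Rabs_pos y) as Py.
  assert (Hc : (Rabs (cos y) <= 1)%R) by (apply Rabs_le; apply COS_bound).
  assert (Hex : (Rabs (exp x - 1) <= 2 * Rabs x)%R).
  { replace (exp x - 1)%R with ((exp x - 1 - 1 * x) + x)%R by ring.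
    eapply Rle_trans; [apply Rabs_triang|]. nra. }
  assert (He4 : (Rabs (exp x) <= 3)%R).
  { replace (exp x) with ((exp x - 1) + 1)%R by ring.
    eapply Rle_trans; [apply Rabs_triang|]. rewrite Rabs_R1. lra. }
  eapply Rle_trans; [apply Cmod_le_abs|].
  unfold Cexp, Cminus, Cplus, Copp, RtoC, Re, Im; simpl.
  replace (exp x * cos y + - (1) + - x)%R
    with ((exp x - 1 - 1 * x) * cos y + (1 + x) * (cos y - 1 - 0 * y))%R by ring.
  replace (exp x * sin y + - 0 + - y)%R
    with (exp x * (sin y - 0 - 1 * y) + (exp x - 1) * y)%R by ring.
  assert (B1 : (Rabs ((exp x - 1 - 1 * x) * cos y + (1 + x) * (cos y - 1 - 0 * y)) <=
                e * Rabs x + 2 * (e * Rabs y))%R).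
  { eapply Rle_trans; [apply Rabs_triang|]. rewrite !Rabs_mult. apply Rplus_le_compat.
    - rewrite <- (Rmult_1_r (e * Rabs x)). apply Rmult_le_compat; auto using Rabs_pos.
    - apply Rmult_le_compat; auto using Rabs_pos.
      eapply Rle_trans; [apply Rabs_triang|]. rewrite Rabs_R1. lra. }
  assert (B2 : (Rabs (exp x * (sin y - 0 - 1 * y) + (exp x - 1) * y) <=
                3 * (e * Rabs y) + 2 * e * Rabs y)%R).
  { eapply Rle_trans; [apply Rabs_triang|]. rewrite !Rabs_mult. apply Rplus_le_compat.
    - apply Rmult_le_compat; auto using Rabs_pos.
    - apply Rmult_le_compat_r; auto. lra. }
  pose proof (Cmod_ge_0 (x, y)).
  assert (e * Rabs x <= e * Cmod (x, y))%R by (apply Rmult_le_compat_l; lra).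
  assert (e * Rabs y <= e * Cmod (x, y))%R by (apply Rmult_le_compat_l; lra).
  nra.
Qed.

Lemma cderiv_Cexp (z : C) : cderiv Cexp z (Cexp z).
Proof.
  assert (Hs : cderiv (fun w => w + - z) z (1 + 0))
    by (apply cderiv_plus; [apply cderiv_id|apply cderiv_const]).
  assert (H0 : littleo ((fun w => w + - z) z) (fun w => Cexp w - 1 - w)).
  { simpl. replace (z + - z) with (RtoC 0) by ring. exact littleo_Cexp_0. }
  pose proof (littleo_comp _ _ _ _ Hs H0) as H1.
  apply littleo_ext with (2 := littleo_mult_bounded _ _ (fun _ => Cexp z) (Cmod (Cexp z)) H1
    (nearC_all _ _ (fun _ => Rle_refl _))).
  apply nearC_all. intros w. simpl.
  replace (Cexp w) with (Cexp (w + - z) * Cexp z); [ring|].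
  rewrite <- Cexp_plus. f_equal. ring.
Qed.

Lemma locally_nearC (z : C) (P : C -> Prop) : @locally C_UniformSpace z P -> nearC z P.
Proof.
  intros [d Hd]. exists d. split; [apply cond_pos|]. intros w Hw. apply Hd.
  pose proof (re_le_Cmod (w - z)) as H1. pose proof (im_le_Cmod (w - z)) as H2.
  split; (eapply Rle_lt_trans; [|exact Hw]); [exact H1|exact H2].
Qed.

Lemma continuous_nearC (phi : C -> R) (z : C) (eps : R) :
  @continuous C_UniformSpace R_UniformSpace phi z -> (0 < eps)%R ->
  nearC z (fun w => (Rabs (phi w - phi z) < eps)%R).
Proof.
  intros H He. apply locally_nearC.
  apply (H (fun t => (Rabs (t - phi z) < eps)%R)).
  exists (mkposreal eps He). intros t Ht. exact Ht.
Qed.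

Lemma Clog_right (z : C) : (0 < Re z)%R -> Clog z = (ln (Cmod z), atan (Im z / Re z)).
Proof. intros H. unfold Clog, Arg. destruct (Rlt_dec 0 (Re z)); [reflexivity|contradiction]. Qed.

Lemma Cexp_Clog_right (z : C) : (0 < Re z)%R -> Cexp (Clog z) = z.
Proof.
  intros H. rewrite Clog_right by exact H. destruct z as [x y]. unfold Cexp, Re, Im in *; simpl in *.
  assert (Hm : Cmod (x, y) = (x * sqrt (1 + (y / x)²))%R).
  { unfold Cmod; simpl fst; simpl snd. rewrite <- (sqrt_Rsqr x) at 2 by lra.
    rewrite <- sqrt_mult_alt by apply Rle_0_sqr. f_equal. unfold Rsqr. field. lra. }
  assert (Hs : (0 < sqrt (1 + (y / x)²))%R).
  { apply sqrt_lt_R0. pose proof (Rle_0_sqr (y / x)). lra. }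
  rewrite exp_ln by (rewrite Hm; apply Rmult_lt_0_compat; lra).
  rewrite cos_atan, sin_atan, Hm. f_equal; field; lra.
Qed.

Lemma continuous_Re (z : C) : @continuous C_UniformSpace R_UniformSpace Re z.
Proof. apply continuous_fst. Qed.

Lemma continuous_Im (z : C) : @continuous C_UniformSpace R_UniformSpace Im z.
Proof. apply continuous_snd. Qed.

Lemma contC_Clog_right (z : C) : (0 < Re z)%R -> contC Clog z.
Proof.
  intros H eps He.
  assert (Hm : (0 < Cmod z)%R) by (pose proof (re_le_Cmod z); pose proof (Rle_abs (Re z)); lra).
  assert (N1 : nearC z (fun w => (Rabs (atan (Im w / Re w) - atan (Im z / Re z)) < eps / 2)%R)).
  { apply (continuous_nearC (fun w => atan (Im w / Re w))); [|lra].
    apply (continuous_comp (U := C_UniformSpace) (fun w : C => (Im w / Re w)%R) atan).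
    - apply (continuous_mult (U := C_UniformSpace) (K := R_AbsRing) Im (fun w : C => (/ Re w)%R)).
      + apply continuous_Im.
      + apply (continuous_comp (U := C_UniformSpace) Re Rinv); [apply continuous_Re|].
        apply continuous_Rinv. lra.
    - apply continuity_pt_filterlim, derivable_continuous_pt, derivable_pt_atan. }
  assert (N2 : nearC z (fun w => (Rabs (ln (Cmod w) - ln (Cmod z)) < eps / 2)%R)).
  { assert (L : continuity_pt ln (Cmod z)).
    { apply derivable_continuous_pt. exists (/ Cmod z)%R. apply derivable_pt_lim_ln. exact Hm. }
    apply continuity_pt_filterlim in L.
    destruct (L (fun t => (Rabs (t - ln (Cmod z)) < eps / 2)%R)) as [d Hd].
    { exists (mkposreal (eps / 2)%R ltac:(lra)). intros t Ht. exact Ht. }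
    exists d. split; [apply cond_pos|]. intros w Hw. apply Hd.
    eapply Rle_lt_trans; [|exact Hw]. apply Rabs_le.
    pose proof (Cmod_triangle (w - z) z) as T1. replace (w - z + z) with w in T1 by ring.
    pose proof (Cmod_triangle (- (w - z)) w) as T2. replace (- (w - z) + w) with z in T2 by ring.
    rewrite Cmod_opp in T2.
    change (- Cmod (w - z) <= Cmod w - Cmod z <= Cmod (w - z))%R. lra. }
  assert (N3 : nearC z (fun w => (Rabs (Re w - Re z) < Re z)%R))
    by (apply continuous_nearC; [apply continuous_Re|exact H]).
  generalize (nearC_and _ _ _ N1 (nearC_and _ _ _ N2 N3)). apply nearC_imp.
  intros w [W1 [W2 W3]].
  assert (Hw : (0 < Re w)%R) by (apply Rabs_def2 in W3; lra).
  rewrite !Clog_right by assumption.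
  eapply Rle_lt_trans; [apply Cmod_le_abs|].
  unfold Cminus, Cplus, Copp; unfold Re at 1, Im at 1; simpl. unfold Rminus in W1, W2. lra.
Qed.

(** Derivative of an inverse function: for [u = Clog w - Clog z] one has [w - z = z (Cexp u - 1)],
    so the remainder of [Clog] at [z] is minus that of [Cexp] at 0, and continuity makes [u]
    small. *)
Lemma cderiv_Clog_right (z : C) : (0 < Re z)%R -> cderiv Clog z (/ z).
Proof.
  intros H.
  assert (Hz : z <> 0) by (intros ->; unfold Re in H; simpl in H; lra).
  pose proof (proj1 (Cmod_gt_0 z) Hz) as Hm.
  assert (N0 : nearC z (fun w => (0 < Re w)%R)).
  { generalize (continuous_nearC Re z (Re z) (continuous_Re z) H). apply nearC_imp.
    intros w Hw. apply Rabs_def2 in Hw. lra. }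
  intros eps He.
  (* [e <= 1/2] gives [|u| <= 2 |Cexp u - 1|]; the second bound pays for this 2 and for the factor
     [|z|] in [|w - z|]. *)
  set (e := Rmin (1 / 2) (eps / 2 * Cmod z)).
  assert (He1 : (0 < e)%R) by (apply Rmin_glb_lt; [lra|]; apply Rmult_lt_0_compat; lra).
  assert (He2 : (e <= 1 / 2)%R) by apply Rmin_l.
  assert (He3 : (e <= eps / 2 * Cmod z)%R) by apply Rmin_r.
  destruct (littleo_Cexp_0 e He1) as [d [Hd Hr]].
  generalize (nearC_and _ _ _ N0 (contC_Clog_right z H d Hd)). apply nearC_imp.
  intros w [Hw0 Hw]. set (u := Clog w - Clog z) in *.
  assert (Hu : (Cmod (Cexp u - 1 - u) <= e * Cmod u)%R).
  { replace (e * Cmod u)%R with (e * Cmod (u - 0))%R by (do 2 f_equal; ring).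
    apply Hr. replace (u - 0) with u by ring. exact Hw. }
  assert (Ew : w - z = z * (Cexp u - 1)).
  { rewrite <- (Cexp_Clog_right w Hw0) at 1. replace (Clog w) with (Clog z + u) by (unfold u; ring).
    rewrite Cexp_plus, (Cexp_Clog_right z H). ring. }
  replace (u - / z * (w - z)) with (- (Cexp u - 1 - u)) by (rewrite Ew; field; exact Hz).
  rewrite Cmod_opp. eapply Rle_trans; [exact Hu|].
  assert (Eu : (Cmod (w - z) = Cmod z * Cmod (Cexp u - 1))%R) by (rewrite Ew; apply Cmod_mult).
  assert (Hu2 : (Cmod u <= 2 * Cmod (Cexp u - 1))%R).
  { pose proof (Cmod_triangle (Cexp u - 1) (- (Cexp u - 1 - u))) as T. rewrite Cmod_opp in T.
    replace (Cexp u - 1 + - (Cexp u - 1 - u)) with u in T by ring.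
    pose proof (Cmod_ge_0 u). nra. }
  rewrite Eu. pose proof (Cmod_ge_0 u). pose proof (Cmod_ge_0 (Cexp u - 1)).
  apply Rle_trans with ((eps / 2 * Cmod z) * (2 * Cmod (Cexp u - 1)))%R.
  - apply Rmult_le_compat; lra.
  - right. field.
Qed.

Lemma Cmod_rot (x y : R) : Cmod (- y, x)%R = Cmod (x, y) /\ Cmod (y, - x)%R = Cmod (x, y).
Proof. unfold Cmod; simpl fst; simpl snd. split; f_equal; ring. Qed.

Lemma atan_div_inv (x y : R) : (0 < x)%R -> (0 < y)%R -> (atan (y / x) = PI / 2 - atan (x / y))%R.
Proof.
  intros Hx Hy. rewrite <- atan_inv by now apply Rdiv_lt_0_compat. f_equal. field. lra.
Qed.

Lemma atan_opp_div (x y : R) : (x <> 0)%R -> (atan (y / x) = - atan (y / - x))%R.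
Proof. intros H. rewrite <- atan_opp. f_equal. field. lra. Qed.

(** A quarter turn moves the upper half-plane onto the right one, where [Arg] is a single
    arctangent; the case distinction of [Arg] at the imaginary axis disappears. *)
Lemma Clog_upper (z : C) : (0 < Im z)%R -> Clog z = RtoC (PI / 2) * Ci + Clog (- Ci * z).
Proof.
  destruct z as [x y]. unfold Im; simpl. intros Hy.
  replace (- Ci * (x, y)) with (y, - x)%R
    by (unfold Ci, Copp, Cmult; simpl; f_equal; ring).
  rewrite (Clog_right (y, - x)%R) by exact Hy. rewrite (proj2 (Cmod_rot x y)).
  unfold Clog, Arg, Ci, RtoC, Cplus, Cmult, Re, Im; simpl. f_equal; [ring|].
  replace (PI / 2 * 1 + 0 * 0 + atan (- x / y))%R with (PI / 2 + atan (- x / y))%R by ring.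
  destruct (Rlt_dec 0 x) as [Hx|Hx].
  - rewrite atan_div_inv by assumption. unfold Rdiv. rewrite Ropp_mult_distr_l_reverse, atan_opp. lra.
  - destruct (Rlt_dec x 0) as [Hx'|Hx'].
    + destruct (Rle_dec 0 y) as [_|]; [|lra].
      rewrite atan_opp_div, atan_div_inv by lra. lra.
    + destruct (Rlt_dec 0 y) as [_|]; [|lra]. replace x with 0%R by lra.
      replace (- 0 / y)%R with 0%R by (field; lra). rewrite atan_0. lra.
Qed.

Lemma Clog_lower (z : C) : (Im z < 0)%R -> Clog z = RtoC (- (PI / 2)) * Ci + Clog (Ci * z).
Proof.
  destruct z as [x y]. unfold Im; simpl. intros Hy.
  replace (Ci * (x, y)) with (- y, x)%R
    by (unfold Ci, Copp, Cmult; simpl; f_equal; ring).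
  rewrite (Clog_right (- y, x)%R) by (unfold Re; simpl; lra). rewrite (proj1 (Cmod_rot x y)).
  unfold Clog, Arg, Ci, RtoC, Cplus, Cmult, Re, Im; simpl. f_equal; [ring|].
  replace (- (PI / 2) * 1 + 0 * 0 + atan (x / - y))%R with (- (PI / 2) + atan (x / - y))%R by ring.
  destruct (Rlt_dec 0 x) as [Hx|Hx].
  - replace (y / x)%R with (- (- y / x))%R by (field; lra).
    rewrite atan_opp, atan_div_inv by lra. lra.
  - destruct (Rlt_dec x 0) as [Hx'|Hx'].
    + destruct (Rle_dec 0 y) as [|_]; [lra|].
      replace (y / x)%R with (- y / - x)%R by (field; lra).
      replace (x / - y)%R with (- (- x / - y))%R by (field; lra).
      rewrite atan_opp, atan_div_inv by lra. lra.
    + destruct (Rlt_dec 0 y) as [|_]; [lra|]. destruct (Rlt_dec y 0) as [_|]; [|lra].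
      replace x with 0%R by lra. replace (0 / - y)%R with 0%R by (field; lra). rewrite atan_0. lra.
Qed.

(** The open right, upper and lower half-planes cover the cut plane, and on each [Clog] is a
    constant plus the right half-plane logarithm of a rotated argument. *)
Lemma cderiv_Clog (z : C) : ~ (Im z = 0%R /\ (Re z <= 0)%R) -> cderiv Clog z (/ z).
Proof.
  intros H.
  assert (rot : forall q k : C, q <> 0 -> (0 < Re (q * z))%R ->
    nearC z (fun w => k + Clog (q * w) = Clog w) -> cderiv Clog z (/ z)).
  { intros q k Hq Hre E. apply cderiv_ext_loc with (1 := E).
    assert (Hz : z <> 0).
    { intros ->. replace (q * 0) with (RtoC 0) in Hre by ring. unfold Re in Hre. simpl in Hre. lra. }
    replace (/ z) with (0 + / (q * z) * (q * 1)) by (field; auto).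
    apply cderiv_plus; [apply cderiv_const|].
    apply (cderiv_comp Clog (fun w => q * w)); [apply cderiv_scal, cderiv_id|].
    now apply cderiv_Clog_right. }
  destruct (Rlt_dec 0 (Re z)) as [Hr|Hr]; [now apply cderiv_Clog_right|].
  destruct (Rlt_dec 0 (Im z)) as [Hi|Hi]; [|destruct (Rlt_dec (Im z) 0) as [Hi'|Hi']; [|exfalso; apply H; lra]].
  - apply (rot (- Ci) (RtoC (PI / 2) * Ci)).
    + intros E. apply (f_equal Cmod) in E. rewrite Cmod_opp, Cmod_Ci, Cmod_0 in E. lra.
    + destruct z as [x y]. unfold Ci, Copp, Cmult, Re, Im in *; simpl in *. lra.
    + generalize (continuous_nearC Im z (Im z) (continuous_Im z) Hi). apply nearC_imp.
      intros w Hw. apply Rabs_def2 in Hw. symmetry. apply Clog_upper. lra.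
  - apply (rot Ci (RtoC (- (PI / 2)) * Ci)).
    + intros E. apply (f_equal Cmod) in E. rewrite Cmod_Ci, Cmod_0 in E. lra.
    + destruct z as [x y]. unfold Ci, Copp, Cmult, Re, Im in *; simpl in *. lra.
    + generalize (continuous_nearC Im z (- Im z) (continuous_Im z) ltac:(lra)). apply nearC_imp.
      intros w Hw. apply Rabs_def2 in Hw. symmetry. apply Clog_lower. lra.
Qed.

Lemma slit_1_minus (z : C) : slit z -> ~ (Im (1 - z) = 0%R /\ (Re (1 - z) <= 0)%R).
Proof.
  intros H [H1 H2]. apply H. destruct z as [x y]. unfold Cminus, Cplus, Copp, Re, Im in *; simpl in *.
  lra.
Qed.

Lemma slit_neq_1 (z : C) : slit z -> 1 - z <> 0.
Proof. intros H E. apply (slit_1_minus z H). rewrite E. unfold Re, Im; simpl. lra. Qed.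

Lemma cderiv_Cpow_1_minus (s z : C) : slit z ->
  cderiv (fun w => Cpow_principal (1 - w) s) z (- s / (1 - z) * Cpow_principal (1 - z) s).
Proof.
  intros H. unfold Cpow_principal.
  pose proof (slit_neq_1 z H) as Hz.
  replace (- s / (1 - z) * Cexp (s * Clog (1 - z)))
    with (Cexp (s * Clog (1 - z)) * (s * (/ (1 - z) * (0 + - (1) * 1)))) by (field; exact Hz).
  apply (cderiv_comp Cexp (fun w => s * Clog (1 - w))); [|apply cderiv_Cexp].
  apply cderiv_scal, (cderiv_comp Clog (fun w => 1 - w)).
  - apply cderiv_ext_loc with (f := fun w => 1 + - (1) * w); [apply nearC_all; intros; ring|].
    apply cderiv_plus; [apply cderiv_const|]. apply cderiv_scal, cderiv_id.
  - apply cderiv_Clog. now apply slit_1_minus.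
Qed.

Lemma Cpow_principal_opp (z s : C) : Cpow_principal z s * Cpow_principal z (- s) = 1.
Proof.
  unfold Cpow_principal. rewrite <- Cexp_plus, <- Cexp_0. f_equal. ring.
Qed.

Lemma Cpow_principal_1 (s : C) : Cpow_principal 1 s = 1.
Proof.
  unfold Cpow_principal. rewrite Clog_right by (unfold Re; simpl; lra).
  rewrite Cmod_1, ln_1. replace (atan (Im 1 / Re 1)) with 0%R.
  - rewrite <- Cexp_0. f_equal. change (0%R, 0%R) with (RtoC 0). ring.
  - rewrite <- atan_0. f_equal. unfold Re, Im; simpl. field.
Qed.

(** * Bisection of rectangles *)

Lemma nested_intervals (A B : nat -> R) :
  (forall n, A n <= A (S n))%R -> (forall n, B (S n) <= B n)%R -> (forall n, A n <= B n)%R ->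
  exists x : R, forall n, (A n <= x <= B n)%R.
Proof.
  intros HA HB HAB.
  assert (mA : forall n k, (A n <= A (n + k)%nat)%R).
  { intros n k. induction k as [|k IH]; [rewrite Nat.add_0_r; lra|].
    rewrite Nat.add_succ_r. pose proof (HA (n + k)%nat). lra. }
  assert (mB : forall n k, (B (n + k)%nat <= B n)%R).
  { intros n k. induction k as [|k IH]; [rewrite Nat.add_0_r; lra|].
    rewrite Nat.add_succ_r. pose proof (HB (n + k)%nat). lra. }
  assert (AB : forall n k, (A n <= B k)%R).
  { intros n k. pose proof (mA n k). pose proof (mB k n) as H1. rewrite (Nat.add_comm k n) in H1.
    pose proof (HAB (n + k)%nat). lra. }
  destruct (completeness (fun y => exists n, y = A n)) as [x [Hx1 Hx2]].
  - exists (B O). intros y [n ->]. apply AB.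
  - exists (A O). now exists O.
  - exists x. intros n. split.
    + apply Hx1. now exists n.
    + apply Hx2. intros y [k ->]. apply AB.
Qed.

Lemma exists_half_pow_lt (L d : R) : (0 <= L)%R -> (0 < d)%R -> exists n : nat, (L * (/ 2) ^ n < d)%R.
Proof.
  intros HL Hd.
  destruct (pow_lt_1_zero (/ 2) ltac:(rewrite Rabs_pos_eq; lra) (d / (L + 1)))%R as [n Hn].
  { apply Rdiv_lt_0_compat; lra. }
  exists n. specialize (Hn n (le_n n)). rewrite Rabs_pos_eq in Hn by (apply pow_le; lra).
  apply Rle_lt_trans with ((L + 1) * (/ 2) ^ n)%R.
  - apply Rmult_le_compat_r; [apply pow_le|]; lra.
  - replace d with ((L + 1) * (d / (L + 1)))%R by (field; lra). apply Rmult_lt_compat_l; lra.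
Qed.

Record rect := Rect { xlo : R; xhi : R; ylo : R; yhi : R }.

Definition subrect (q r : rect) : Prop :=
  (xlo r <= xlo q /\ xlo q <= xhi q /\ xhi q <= xhi r /\
   ylo r <= ylo q /\ ylo q <= yhi q /\ yhi q <= yhi r)%R.

Definition in_rect (z : C) (r : rect) : Prop :=
  (xlo r <= Re z <= xhi r /\ ylo r <= Im z <= yhi r)%R.

Definition quarter (r : rect) (left bottom : bool) : rect :=
  let x := ((xlo r + xhi r) / 2)%R in let y := ((ylo r + yhi r) / 2)%R in
  Rect (if left then xlo r else x) (if left then x else xhi r)
       (if bottom then ylo r else y) (if bottom then y else yhi r).

Definition rect_ok (r : rect) : Prop := (xlo r <= xhi r /\ ylo r <= yhi r)%R.

Lemma in_subrect (z : C) (q r : rect) : subrect q r -> in_rect z q -> in_rect z r.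
Proof. unfold subrect, in_rect. lra. Qed.

(** If [P] failed on [r0], it would fail on some quarter, and so on; the nested failing rectangles
    shrink to a point, against the local hypothesis there. This one principle provides both
    compactness and Goursat's subdivision. *)
Lemma rect_bisection (P : rect -> Prop) (r0 : rect) :
  rect_ok r0 ->
  (forall r, subrect r r0 -> (forall l b, P (quarter r l b)) -> P r) ->
  (forall z, in_rect z r0 -> exists delta : R, (0 < delta)%R /\
     forall r, subrect r r0 -> in_rect z r ->
       (xhi r - xlo r < delta)%R -> (yhi r - ylo r < delta)%R -> P r) ->
  P r0.
Proof.
  intros Hok Hadd Hloc. apply NNPP. intros HP.
  (* The sigma type carries the invariant, so that dependent choice becomes the iteration of a
     function. *)
  assert (step : forall r : {r | subrect r r0 /\ ~ P r},
    {q : {r | subrect r r0 /\ ~ P r} | exists l b, proj1_sig q = quarter (proj1_sig r) l b}).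
  { intros [r [Hr HPr]]. apply constructive_indefinite_description.
    apply NNPP. intros HN. apply HPr, Hadd; [exact Hr|]. intros l b. apply NNPP. intros HQ.
    apply HN.
    assert (Hq : subrect (quarter r l b) r0 /\ ~ P (quarter r l b)).
    { split; [|exact HQ]. unfold subrect in *. destruct l, b; simpl; lra. }
    exists (exist (fun r => subrect r r0 /\ ~ P r) _ Hq). now exists l, b. }
  assert (H0 : subrect r0 r0 /\ ~ P r0) by (unfold subrect, rect_ok in *; split; [lra|exact HP]).
  pose (seq := fix seq (n : nat) : {r | subrect r r0 /\ ~ P r} :=
    match n with O => exist (fun r => subrect r r0 /\ ~ P r) r0 H0 | S k => proj1_sig (step (seq k)) end).
  pose (R n := proj1_sig (seq n)).
  assert (HR : forall n, subrect (R n) r0 /\ ~ P (R n)) by (intros n; exact (proj2_sig (seq n))).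
  assert (HS : forall n, exists l b, R (S n) = quarter (R n) l b)
    by (intros n; exact (proj2_sig (step (seq n)))).
  destruct (nested_intervals (fun n => xlo (R n)) (fun n => xhi (R n))) as [x Hx].
  1-3: intros n; destruct (HR n) as [Hn _]; unfold subrect in Hn; try lra;
       destruct (HS n) as [l [b E]]; rewrite E; destruct l; simpl; lra.
  destruct (nested_intervals (fun n => ylo (R n)) (fun n => yhi (R n))) as [y Hy].
  1-3: intros n; destruct (HR n) as [Hn _]; unfold subrect in Hn; try lra;
       destruct (HS n) as [l [b E]]; rewrite E; destruct b; simpl; lra.
  assert (Hsize : forall n, (xhi (R n) - xlo (R n) = (xhi r0 - xlo r0) * (/ 2) ^ n /\
                             yhi (R n) - ylo (R n) = (yhi r0 - ylo r0) * (/ 2) ^ n)%R).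
  { induction n as [|n [IH1 IH2]]; [unfold R; simpl; lra|].
    destruct (HS n) as [l [b E]]. rewrite E.
    replace ((/ 2) ^ S n)%R with ((/ 2) ^ n * / 2)%R by (simpl; ring).
    rewrite <- !Rmult_assoc, <- IH1, <- IH2.
    destruct l, b; simpl; split; lra. }
  destruct (Hloc (x, y)) as [d [Hd HL]].
  { exact (conj (Hx O) (Hy O)). }
  destruct Hok as [Hok1 Hok2].
  destruct (exists_half_pow_lt (xhi r0 - xlo r0 + (yhi r0 - ylo r0)) d ltac:(lra) Hd) as [n Hn].
  apply (proj2 (HR n)), HL.
  - apply (HR n).
  - exact (conj (Hx n) (Hy n)).
  - destruct (Hsize n) as [-> _]. rewrite Rmult_plus_distr_r in Hn.
    assert (0 <= (yhi r0 - ylo r0) * (/ 2) ^ n)%R by (apply Rmult_le_pos; [|apply pow_le]; lra). lra.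
  - destruct (Hsize n) as [_ ->]. rewrite Rmult_plus_distr_r in Hn.
    assert (0 <= (xhi r0 - xlo r0) * (/ 2) ^ n)%R by (apply Rmult_le_pos; [|apply pow_le]; lra). lra.
Qed.

Lemma in_quarter (z : C) (r : rect) : in_rect z r -> exists l b, in_rect z (quarter r l b).
Proof.
  intros [Hx Hy]. unfold in_rect.
  exists (if Rle_dec (Re z) ((xlo r + xhi r) / 2) then true else false),
         (if Rle_dec (Im z) ((ylo r + yhi r) / 2) then true else false).
  destruct (Rle_dec (Re z) _), (Rle_dec (Im z) _); simpl; lra.
Qed.

Lemma in_rect_close (z w : C) (r : rect) (d : R) : in_rect z r -> in_rect w r ->
  (xhi r - xlo r < d)%R -> (yhi r - ylo r < d)%R -> (Cmod (w - z) < 2 * d)%R.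
Proof.
  unfold in_rect. intros Hz Hw H1 H2. eapply Rle_lt_trans; [apply Cmod_le_abs|].
  destruct z as [x y], w as [x' y']. unfold Cminus, Cplus, Copp, Re, Im in *; simpl in *.
  assert (Rabs (x' + - x) < d)%R by (apply Rabs_def1; lra).
  assert (Rabs (y' + - y) < d)%R by (apply Rabs_def1; lra). lra.
Qed.

(** In place of a finite subcover, local witnesses are merged by [join] along the subdivision: a
    maximum for upper bounds, a minimum for positive gaps. *)
Lemma rect_compact (A : Type) (P : A -> C -> Prop) (join : A -> A -> A) (r0 : rect) :
  rect_ok r0 ->
  (forall s t z, P s z -> P (join s t) z) -> (forall s t z, P t z -> P (join s t) z) ->
  (forall z, in_rect z r0 -> exists s, nearC z (fun w => in_rect w r0 -> P s w)) ->
  exists s, forall z, in_rect z r0 -> P s z.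
Proof.
  intros Hok J1 J2 Hloc.
  apply (rect_bisection (fun r => exists s, forall z, in_rect z r -> P s z)); [exact Hok| |].
  - intros r Hr HQ.
    destruct (HQ true true) as [s1 H1]. destruct (HQ true false) as [s2 H2].
    destruct (HQ false true) as [s3 H3]. destruct (HQ false false) as [s4 H4].
    exists (join (join s1 s2) (join s3 s4)). intros z Hz.
    destruct (in_quarter z r Hz) as [[|] [[|] Hq]]; auto.
  - intros z Hz. destruct (Hloc z Hz) as [s [d [Hd Hs]]].
    exists (d / 2)%R. split; [lra|]. intros r Hr Hzr Hw Hh. exists s. intros w Hwr.
    apply Hs; [|now apply in_subrect with r].
    pose proof (in_rect_close z w r (d / 2) Hzr Hwr Hw Hh). lra.
Qed.

(** A supremum that is not attained leaves a positive gap near each point; compactness makes the gap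
    uniform, which contradicts its being the least upper bound. *)
Lemma rect_max (phi : C -> R) (r0 : rect) : rect_ok r0 ->
  (forall z, in_rect z r0 -> forall eps, (0 < eps)%R -> nearC z (fun w => (Rabs (phi w - phi z) < eps)%R)) ->
  exists p, in_rect p r0 /\ forall z, in_rect z r0 -> (phi z <= phi p)%R.
Proof.
  intros Hok Hc.
  assert (Hb : exists B, forall z, in_rect z r0 -> (phi z <= B)%R).
  { apply (rect_compact R (fun B z => (phi z <= B)%R) Rmax); [exact Hok| | |].
    - intros s t z H. pose proof (Rmax_l s t). lra.
    - intros s t z H. pose proof (Rmax_r s t). lra.
    - intros z Hz. exists (phi z + 1)%R. generalize (Hc z Hz 1%R Rlt_0_1). apply nearC_imp.
      intros w Hw _. apply Rabs_def2 in Hw. lra. }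
  destruct (completeness (fun y => exists z, in_rect z r0 /\ y = phi z)) as [M [HM1 HM2]].
  - destruct Hb as [B HB]. exists B. intros y [z [Hz ->]]. now apply HB.
  - exists (phi (xlo r0, ylo r0)), (xlo r0, ylo r0).
    split; [|reflexivity]. unfold in_rect, rect_ok in *; simpl; lra.
  - assert (HM : forall z, in_rect z r0 -> (phi z <= M)%R) by (intros z Hz; apply HM1; now exists z).
    apply NNPP. intros HN.
    assert (Hlt : forall z, in_rect z r0 -> (phi z < M)%R).
    { intros z Hz. apply Rnot_le_lt. intros H. apply HN. exists z. split; [exact Hz|].
      intros w Hw. specialize (HM w Hw). lra. }
    assert (He : exists eta : posreal, forall z, in_rect z r0 -> (phi z <= M - eta)%R).
    { apply (rect_compact posreal (fun eta z => (phi z <= M - eta)%R)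
        (fun s t => mkposreal (Rmin s t) (Rmin_stable_in_posreal s t))); [exact Hok| | |].
      - intros s t z H. simpl. pose proof (Rmin_l s t). lra.
      - intros s t z H. simpl. pose proof (Rmin_r s t). lra.
      - intros z Hz. specialize (Hlt z Hz).
        exists (mkposreal ((M - phi z) / 2) ltac:(lra)). simpl.
        generalize (Hc z Hz ((M - phi z) / 2)%R ltac:(lra)). apply nearC_imp.
        intros w Hw _. apply Rabs_def2 in Hw. lra. }
    destruct He as [eta He].
    assert (M <= M - eta)%R.
    { apply HM2. intros y [z [Hz ->]]. now apply He. }
    pose proof (cond_pos eta). lra.
Qed.

(** * Goursat's theorem and the maximum modulus principle *)

(** Since [k dz = k dx + i k dy], the imaginary part of the integral takes [Re k] on vertical sides
    and [Im k] on horizontal ones. In logarithmic polar coordinates the vertical integral is that of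
    the real part over the angle. *)
Definition vint (k : C -> C) (x c d : R) : R := RInt (fun y => Re (k (x, y))) c d.
Definition hint (k : C -> C) (y a b : R) : R := RInt (fun x => Im (k (x, y))) a b.

(* The imaginary part of the integral of [k] along the boundary of the rectangle. *)
Definition boundary_int (k : C -> C) (r : rect) : R :=
  (vint k (xhi r) (ylo r) (yhi r) - vint k (xlo r) (ylo r) (yhi r) -
   (hint k (yhi r) (xlo r) (xhi r) - hint k (ylo r) (xlo r) (xhi r)))%R.

Lemma contC_vert (k : C -> C) (x y : R) : contC k (x, y) -> continuous (fun t => Re (k (x, t))) y.
Proof.
  intros H P [d Hd]. destruct (H d (cond_pos d)) as [e [He Hk]].
  exists (mkposreal e He). intros t Ht. apply Hd.
  eapply Rle_lt_trans; [apply (re_le_Cmod (k (x, t) - k (x, y)))|]. apply Hk.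
  eapply Rle_lt_trans; [apply Cmod_le_abs|].
  unfold Cminus, Cplus, Copp, Re, Im; simpl. rewrite Rplus_opp_r, Rabs_R0, Rplus_0_l. exact Ht.
Qed.

Lemma contC_horiz (k : C -> C) (x y : R) : contC k (x, y) -> continuous (fun t => Im (k (t, y))) x.
Proof.
  intros H P [d Hd]. destruct (H d (cond_pos d)) as [e [He Hk]].
  exists (mkposreal e He). intros t Ht. apply Hd.
  eapply Rle_lt_trans; [apply (im_le_Cmod (k (t, y) - k (x, y)))|]. apply Hk.
  eapply Rle_lt_trans; [apply Cmod_le_abs|].
  unfold Cminus, Cplus, Copp, Re, Im; simpl. rewrite Rplus_opp_r, Rabs_R0, Rplus_0_r. exact Ht.
Qed.

Definition holo_on (k : C -> C) (r : rect) : Prop := forall z, in_rect z r -> exists l, cderiv k z l.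

Lemma ex_vint (k : C -> C) (r : rect) (x c d : R) : holo_on k r ->
  (xlo r <= x <= xhi r)%R -> (ylo r <= c)%R -> (c <= d)%R -> (d <= yhi r)%R ->
  ex_RInt (fun y => Re (k (x, y))) c d.
Proof.
  intros H Hx Hc Hcd Hd. apply (ex_RInt_continuous (V := R_CompleteNormedModule)). intros y Hy.
  rewrite Rmin_left, Rmax_right in Hy by exact Hcd.
  apply contC_vert. destruct (H (x, y)) as [l Hl]; [|exact (cderiv_contC _ _ _ Hl)].
  unfold in_rect; simpl; lra.
Qed.

Lemma ex_hint (k : C -> C) (r : rect) (y a b : R) : holo_on k r ->
  (ylo r <= y <= yhi r)%R -> (xlo r <= a)%R -> (a <= b)%R -> (b <= xhi r)%R ->
  ex_RInt (fun x => Im (k (x, y))) a b.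
Proof.
  intros H Hy Ha Hab Hb. apply (ex_RInt_continuous (V := R_CompleteNormedModule)). intros x Hx.
  rewrite Rmin_left, Rmax_right in Hx by exact Hab.
  apply contC_horiz. destruct (H (x, y)) as [l Hl]; [|exact (cderiv_contC _ _ _ Hl)].
  unfold in_rect; simpl; lra.
Qed.

Lemma boundary_int_quarters (k : C -> C) (r r0 : rect) : holo_on k r0 -> subrect r r0 ->
  boundary_int k r =
  (boundary_int k (quarter r true true) + boundary_int k (quarter r false true) +
   boundary_int k (quarter r true false) + boundary_int k (quarter r false false))%R.
Proof.
  intros H Hr. destruct r as [a b c d]. unfold subrect in Hr. simpl in Hr.
  unfold boundary_int, quarter; simpl. set (x := ((a + b) / 2)%R). set (y := ((c + d) / 2)%R).
  assert (Hx : (a <= x <= b)%R) by (unfold x; lra). assert (Hy : (c <= y <= d)%R) by (unfold y; lra).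
  assert (V : forall t, (a <= t <= b)%R -> (vint k t c y + vint k t y d = vint k t c d)%R).
  { intros t Ht. apply (RInt_Chasles (V := R_CompleteNormedModule)); apply ex_vint with r0; auto; lra. }
  assert (W : forall t, (c <= t <= d)%R -> (hint k t a x + hint k t x b = hint k t a b)%R).
  { intros t Ht. apply (RInt_Chasles (V := R_CompleteNormedModule)); apply ex_hint with r0; auto; lra. }
  rewrite <- !V, <- !W by lra. ring.
Qed.

Lemma RInt_near_const (f g : R -> R) (a b q M : R) : (a <= b)%R ->
  ex_RInt f a b -> ex_RInt g a b ->
  (forall t, (a <= t <= b)%R -> (Rabs (f t - g t - q) <= M)%R) ->
  (Rabs (RInt f a b - RInt g a b - q * (b - a)) <= (b - a) * M)%R.
Proof.
  intros Hab Hf Hg HM.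
  assert (Hfg : ex_RInt (fun t => f t - g t)%R a b)
    by exact (ex_RInt_minus (V := R_NormedModule) f g a b Hf Hg).
  assert (Hc : ex_RInt (fun _ : R => q) a b) by apply (ex_RInt_const (V := R_NormedModule)).
  replace (RInt f a b - RInt g a b - q * (b - a))%R with (RInt (fun t => f t - g t - q)%R a b).
  - apply abs_RInt_le_const; [exact Hab| |exact HM].
    exact (ex_RInt_minus (V := R_NormedModule) _ _ a b Hfg Hc).
  - transitivity (RInt (fun t => f t - g t)%R a b - RInt (fun _ : R => q) a b)%R.
    { exact (RInt_minus (V := R_CompleteNormedModule) _ _ a b Hfg Hc). }
    transitivity (RInt f a b - RInt g a b - RInt (fun _ : R => q) a b)%R.
    { f_equal. exact (RInt_minus (V := R_CompleteNormedModule) f g a b Hf Hg). }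
    f_equal. rewrite RInt_const. unfold scal; simpl; unfold mult; simpl. ring.
Qed.

Lemma goursat (k : C -> C) (r0 : rect) : rect_ok r0 -> holo_on k r0 -> boundary_int k r0 = 0%R.
Proof.
  intros Hok Hk.
  (* Half the perimeter: its square drops to a quarter on each of the four quarters, so the bound
     [eps * size^2] is exactly additive under subdivision. *)
  set (size := fun r => (xhi r - xlo r + (yhi r - ylo r))%R).
  assert (small : forall eps, (0 < eps)%R -> (Rabs (boundary_int k r0) <= eps * (size r0 * size r0))%R).
  { intros eps He.
    apply (rect_bisection (fun r => (Rabs (boundary_int k r) <= eps * (size r * size r))%R));
      [exact Hok| |].
    - intros r Hr HQ. rewrite (boundary_int_quarters k r r0 Hk Hr).
      pose proof (HQ true true) as Q1. pose proof (HQ true false) as Q2.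
      pose proof (HQ false true) as Q3. pose proof (HQ false false) as Q4.
      assert (S : forall l b, size (quarter r l b) = (size r / 2)%R).
      { intros l b. unfold size. destruct l, b; simpl; lra. }
      rewrite S in Q1, Q2, Q3, Q4.
      eapply Rle_trans; [apply Rabs_triang|]. eapply Rle_trans.
      { apply Rplus_le_compat_r. eapply Rle_trans; [apply Rabs_triang|].
        apply Rplus_le_compat_r, Rabs_triang. }
      lra.
    - intros z Hz. destruct (Hk z Hz) as [l Hl].
      destruct (Hl (eps / 2)%R ltac:(lra)) as [d [Hd HD]].
      exists (d / 2)%R. split; [lra|]. intros r Hr Hzr Hw Hh.
      assert (pt : forall w, in_rect w r ->
        (Cmod (k w - k z - l * (w - z)) <= eps / 2 * size r)%R).
      { intros w Hwr. eapply Rle_trans.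
        - apply HD. pose proof (in_rect_close z w r (d / 2) Hzr Hwr Hw Hh). lra.
        - apply Rmult_le_compat_l; [lra|]. eapply Rle_trans; [apply Cmod_le_abs|].
          unfold in_rect, size in *. destruct z as [x y], w as [x' y'].
          unfold Cminus, Cplus, Copp, Re, Im in *; simpl in *.
          apply Rplus_le_compat; apply Rabs_le; lra. }
      assert (two : forall w w', in_rect w r -> in_rect w' r ->
        (Cmod (k w - k w' - l * (w - w')) <= eps * size r)%R).
      { intros w w' H1 H2.
        replace (k w - k w' - l * (w - w'))
          with ((k w - k z - l * (w - z)) + - (k w' - k z - l * (w' - z))) by ring.
        eapply Rle_trans; [apply Cmod_triangle|]. rewrite Cmod_opp.
        pose proof (pt w H1). pose proof (pt w' H2). lra. }
      destruct r as [a b c e]. unfold in_rect, subrect in *. simpl in *.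
      (* The affine part of [k] contributes [Re l (b-a) (e-c)] to the vertical difference and, since
         a vertical displacement carries a factor i, the same to the horizontal one; the two
         cancel. *)
      assert (B1 : (Rabs (vint k b c e - vint k a c e - Re l * (b - a) * (e - c)) <=
                    (e - c) * (eps * size (Rect a b c e)))%R).
      { apply RInt_near_const; try (apply ex_vint with r0; auto; lra); [lra|].
        intros t Ht.
        eapply Rle_trans; [|apply (two (b, t) (a, t)); simpl; lra].
        eapply Rle_trans; [|apply re_le_Cmod]. right. f_equal.
        destruct l as [l1 l2], (k (b, t)) as [u1 u2], (k (a, t)) as [v1 v2].
        unfold Cminus, Cplus, Copp, Cmult, Re, Im; simpl. ring. }
      assert (B2 : (Rabs (hint k e a b - hint k c a b - Re l * (e - c) * (b - a)) <=
                    (b - a) * (eps * size (Rect a b c e)))%R).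
      { apply RInt_near_const; try (apply ex_hint with r0; auto; lra); [lra|].
        intros t Ht.
        eapply Rle_trans; [|apply (two (t, e) (t, c)); simpl; lra].
        eapply Rle_trans; [|apply im_le_Cmod]. right. f_equal.
        destruct l as [l1 l2], (k (t, e)) as [u1 u2], (k (t, c)) as [v1 v2].
        unfold Cminus, Cplus, Copp, Cmult, Re, Im; simpl. ring. }
      unfold boundary_int; simpl.
      replace (vint k b c e - vint k a c e - (hint k e a b - hint k c a b))%R with
        ((vint k b c e - vint k a c e - Re l * (b - a) * (e - c)) +
         - (hint k e a b - hint k c a b - Re l * (e - c) * (b - a)))%R by ring.
      eapply Rle_trans; [apply Rabs_triang|]. rewrite Rabs_Ropp.
      eapply Rle_trans; [exact (Rplus_le_compat _ _ _ _ B1 B2)|].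
      unfold size; simpl. right. ring. }
  apply NNPP. intros H0. pose proof (Rabs_pos_lt _ H0) as HA.
  assert (HS : (0 <= size r0 * size r0)%R) by apply Rle_0_sqr.
  assert (He : (0 < Rabs (boundary_int k r0) / (2 * (size r0 * size r0 + 1)))%R)
    by (apply Rdiv_lt_0_compat; lra).
  specialize (small _ He).
  assert (Rabs (boundary_int k r0) / (2 * (size r0 * size r0 + 1)) * (size r0 * size r0) <
    Rabs (boundary_int k r0) / (2 * (size r0 * size r0 + 1)) * (2 * (size r0 * size r0 + 1)))%R
    by (apply Rmult_lt_compat_l; lra).
  assert (E : (Rabs (boundary_int k r0) / (2 * (size r0 * size r0 + 1)) * (2 * (size r0 * size r0 + 1)) =
    Rabs (boundary_int k r0))%R) by (field; lra).
  lra.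
Qed.

Lemma Cmod_Cexp (z : C) : Cmod (Cexp z) = exp (Re z).
Proof.
  unfold Cexp, Cmod. simpl fst; simpl snd.
  replace ((exp (Re z) * cos (Im z)) ^ 2 + (exp (Re z) * sin (Im z)) ^ 2)%R with (exp (Re z) ^ 2)%R.
  - apply sqrt_pow2. left. apply exp_pos.
  - pose proof (sin2_cos2 (Im z)) as H. unfold Rsqr in H.
    replace ((exp (Re z) * cos (Im z)) ^ 2 + (exp (Re z) * sin (Im z)) ^ 2)%R
      with (exp (Re z) ^ 2 * (sin (Im z) * sin (Im z) + cos (Im z) * cos (Im z)))%R by ring.
    rewrite H. ring.
Qed.

(* Goursat's theorem in logarithmic polar coordinates around [p] shows that the mean of [g] over
   a circle does not depend on the radius; it tends to [g p] for small radii. *)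
Lemma circle_mean_not_below (g : C -> C) (p : C) (rad eta : R) : (0 < rad)%R -> (0 < eta)%R ->
  (forall w, (Cmod (w - p) <= rad)%R -> exists l, cderiv g w l) ->
  ~ (forall w, Cmod (w - p) = rad -> (Re (g w) <= Re (g p) - eta)%R).
Proof.
  intros Hrad Heta Hg Hneg.
  set (k := fun zeta => g (p + Cexp zeta)).
  assert (Emod : forall zeta, Cmod (p + Cexp zeta - p) = exp (Re zeta)).
  { intros zeta. replace (p + Cexp zeta - p) with (Cexp zeta) by ring. apply Cmod_Cexp. }
  assert (Hp : nearC p (fun w => (Cmod (g w - g p) < eta / 2)%R)).
  { destruct (Hg p) as [l Hl]; [|exact (cderiv_contC _ _ _ Hl (eta / 2)%R ltac:(lra))].
    replace (p - p) with (RtoC 0) by ring. rewrite Cmod_0. lra. }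
  destruct Hp as [d [Hd Hp]].
  (* The inner radius [exp rho1] is at most [d/2], well inside the disc on which [g] is within
     [eta/2] of [g p]. *)
  set (rho1 := Rmin (ln rad) (ln (d / 2))).
  assert (L1 : (rho1 <= ln rad)%R) by apply Rmin_l.
  assert (L2 : (exp rho1 < d)%R).
  { apply Rle_lt_trans with (exp (ln (d / 2))).
    - destruct (Rmin_r (ln rad) (ln (d / 2))) as [H|H];
        [left; now apply exp_increasing|right; unfold rho1; now rewrite H].
    - rewrite exp_ln by lra. lra. }
  pose proof PI_RGT_0 as HPI.
  set (r := Rect rho1 (ln rad) 0 (2 * PI)).
  assert (Hr : rect_ok r) by (unfold rect_ok, r; simpl; lra).
  assert (Hk : holo_on k r).
  { intros zeta [Hz _]. unfold r in Hz; simpl in Hz.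
    destruct (Hg (p + Cexp zeta)) as [l Hl].
    - rewrite Emod. rewrite <- (exp_ln rad) by exact Hrad.
      destruct (proj2 Hz) as [H|H]; [left; now apply exp_increasing|right; now rewrite H].
    - exists (l * (0 + Cexp zeta)). apply (cderiv_comp g (fun zeta => p + Cexp zeta)); [|exact Hl].
      apply cderiv_plus; [apply cderiv_const|apply cderiv_Cexp]. }
  pose proof (goursat k r Hr Hk) as G. unfold boundary_int, r in G; simpl in G.
  (* The horizontal sides at heights 0 and [2 PI] cancel by periodicity, so Goursat's theorem
     equates the two vertical integrals. *)
  assert (Eh : hint k (2 * PI) rho1 (ln rad) = hint k 0 rho1 (ln rad)).
  { unfold hint. apply (RInt_ext (V := R_CompleteNormedModule)). intros x _. unfold k, Cexp, Re, Im; simpl.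
    now rewrite cos_2PI, sin_2PI, cos_0, sin_0. }
  assert (V1 : ex_RInt (fun y => Re (k (ln rad, y))) 0 (2 * PI))
    by (apply ex_vint with r; auto; unfold r; simpl; lra).
  assert (V2 : ex_RInt (fun y => Re (k (rho1, y))) 0 (2 * PI))
    by (apply ex_vint with r; auto; unfold r; simpl; lra).
  assert (I1 : (vint k (ln rad) 0 (2 * PI) <= (2 * PI - 0) * (Re (g p) - eta))%R).
  { rewrite <- (RInt_const (V := R_CompleteNormedModule) 0 (2 * PI) (Re (g p) - eta)%R : _ = (_ * _)%R).
    apply RInt_le; [lra|exact V1|apply (ex_RInt_const (V := R_NormedModule))|].
    intros y _. apply Hneg. rewrite Emod. unfold Re; simpl. now apply exp_ln. }
  assert (I2 : ((2 * PI - 0) * (Re (g p) - eta / 2) <= vint k rho1 0 (2 * PI))%R).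
  { rewrite <- (RInt_const (V := R_CompleteNormedModule) 0 (2 * PI) (Re (g p) - eta / 2)%R : _ = (_ * _)%R).
    apply RInt_le; [lra|apply (ex_RInt_const (V := R_NormedModule))|exact V2|].
    intros y _. unfold k. specialize (Hp (p + Cexp (rho1, y))).
    rewrite Emod in Hp. specialize (Hp L2).
    pose proof (re_le_Cmod (g (p + Cexp (rho1, y)) - g p)) as H.
    assert (H' : (Rabs (Re (g (p + Cexp (rho1, y)) - g p)%C) < eta / 2)%R) by lra.
    apply Rabs_def2 in H'. revert H'. unfold Cminus, Cplus, Copp, Re; simpl. lra. }
  nra.
Qed.

(** * Maximum modulus on rectangles *)

Definition on_edge (z : C) (r : rect) : Prop :=
  (Re z = xlo r \/ Re z = xhi r \/ Im z = ylo r \/ Im z = yhi r)%R.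

Definition sqnorm (z : C) : R := (Re z * Re z + Im z * Im z)%R.

Lemma continuous_sqnorm (z : C) : @continuous C_UniformSpace R_UniformSpace sqnorm z.
Proof.
  apply (continuous_plus (U := C_UniformSpace) (V := R_NormedModule) (fun w : C => (Re w * Re w)%R) (fun w : C => (Im w * Im w)%R)).
  - apply (continuous_mult (U := C_UniformSpace) (K := R_AbsRing) Re Re); apply continuous_Re.
  - apply (continuous_mult (U := C_UniformSpace) (K := R_AbsRing) Im Im); apply continuous_Im.
Qed.

Lemma sqnorm_Cmod (z : C) : sqnorm z = (Cmod z * Cmod z)%R.
Proof. unfold sqnorm. pose proof (Cmod2_alt z). simpl in H. lra. Qed.

Lemma interior_disc (p : C) (r : rect) : in_rect p r -> ~ on_edge p r ->
  exists rad, (0 < rad)%R /\ forall w, (Cmod (w - p) <= rad)%R -> in_rect w r.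
Proof.
  unfold in_rect, on_edge. intros Hp Hne.
  set (rad := Rmin (Rmin (Re p - xlo r) (xhi r - Re p)) (Rmin (Im p - ylo r) (yhi r - Im p))).
  exists rad. split.
  - unfold rad. repeat apply Rmin_glb_lt; lra.
  - intros w Hw.
    pose proof (Rmin_l (Rmin (Re p - xlo r) (xhi r - Re p)) (Rmin (Im p - ylo r) (yhi r - Im p))) as A1.
    pose proof (Rmin_r (Rmin (Re p - xlo r) (xhi r - Re p)) (Rmin (Im p - ylo r) (yhi r - Im p))) as A2.
    pose proof (Rmin_l (Re p - xlo r) (xhi r - Re p)). pose proof (Rmin_r (Re p - xlo r) (xhi r - Re p)).
    pose proof (Rmin_l (Im p - ylo r) (yhi r - Im p)). pose proof (Rmin_r (Im p - ylo r) (yhi r - Im p)).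
    fold rad in A1, A2.
    pose proof (re_le_Cmod (w - p)) as B1. pose proof (im_le_Cmod (w - p)) as B2.
    apply Rle_trans with (r3 := rad) in B1; [|exact Hw].
    apply Rle_trans with (r3 := rad) in B2; [|exact Hw].
    apply Rabs_le_between in B1, B2. revert B1 B2.
    destruct w as [x y], p as [x0 y0]. unfold Cminus, Cplus, Copp, Re, Im in *; simpl in *. lra.
Qed.

(* At an interior maximum of [Re (conj(g w) g) + eps |z|^2] the strictly convex term would push
   the mean of the holomorphic part over a small circle below its value at the centre. *)
Lemma maximum_modulus (g : C -> C) (r : rect) (M : R) (w : C) :
  holo_on g r -> in_rect w r ->
  (forall z, in_rect z r -> on_edge z r -> (Cmod (g z) <= M)%R) -> (Cmod (g w) <= M)%R.
Proof.
  intros Hg Hw HM. apply Rnot_lt_le. intros Hlt.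
  assert (Hok : rect_ok r) by (unfold rect_ok, in_rect in *; lra).
  set (A := Cmod (g w)) in *.
  (* The constant factor makes the value at [w] equal to [|g w|^2], so that real parts can stand for
     moduli. *)
  set (G := fun z => Cconj (g w) * g z).
  assert (HG : holo_on G r).
  { intros z Hz. destruct (Hg z Hz) as [l Hl]. exists (Cconj (g w) * l). now apply cderiv_scal. }
  assert (HA : (0 <= A)%R) by apply Cmod_ge_0.
  assert (HGw : Re (G w) = (A * A)%R).
  { unfold A. rewrite <- sqnorm_Cmod. unfold G, sqnorm.
    destruct (g w) as [u v]. unfold Cconj, Cmult, Re, Im; simpl. ring. }
  assert (Hsq : forall z, (0 <= sqnorm z)%R) by (intros z; unfold sqnorm; nra).
  destruct (rect_max sqnorm r Hok) as [q [_ Hq]].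
  { intros z _ eps He. now apply continuous_nearC; [apply continuous_sqnorm|]. }
  set (K := sqnorm q). assert (HK : (0 <= K)%R) by apply Hsq.
  destruct (Rle_lt_or_eq_dec 0 A HA) as [HA'|HA'].
  2:{ (* Then [M < 0], impossible at a corner. *)
      assert (H : (Cmod (g (xlo r, ylo r)) <= M)%R).
      { apply HM; unfold in_rect, on_edge, rect_ok in *; simpl; [lra|now left]. }
      pose proof (Cmod_ge_0 (g (xlo r, ylo r))). lra. }
  assert (HAM : (0 < A * (A - M))%R) by (apply Rmult_lt_0_compat; lra).
  (* Small enough that a maximum on the edge, at most [A M + eps K], stays below the value at [w],
     which is at least [A^2]; [K + 1] avoids a zero denominator. *)
  set (eps := ((A * A - A * M) / (2 * (K + 1)))%R).
  assert (Heps : (0 < eps)%R) by (apply Rdiv_lt_0_compat; nra).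
  assert (HepsK : (eps * K < A * A - A * M)%R).
  { apply Rle_lt_trans with (eps * (K + 1))%R; [nra|].
    replace (eps * (K + 1))%R with ((A * A - A * M) / 2)%R by (unfold eps; field; lra). lra. }
  destruct (rect_max (fun z => Re (G z) + eps * sqnorm z)%R r Hok) as [p [Hp Hmax]].
  { intros z Hz e He. destruct (HG z Hz) as [l Hl].
    assert (N1 := cderiv_contC _ _ _ Hl (e / 2)%R ltac:(lra)).
    assert (He' : (0 < e / 2 / eps)%R) by (repeat apply Rdiv_lt_0_compat; lra).
    assert (N2 := continuous_nearC sqnorm z _ (continuous_sqnorm z) He').
    generalize (nearC_and _ _ _ N1 N2). apply nearC_imp. intros v [H1 H2].
    replace (Re (G v) + eps * sqnorm v - (Re (G z) + eps * sqnorm z))%R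
      with (Re (G v - G z)%C + eps * (sqnorm v - sqnorm z))%R
      by (unfold Cminus, Cplus, Copp, Re; simpl; ring).
    eapply Rle_lt_trans; [apply Rabs_triang|].
    pose proof (re_le_Cmod (G v - G z)). rewrite Rabs_mult, (Rabs_pos_eq eps) by lra.
    apply Rmult_lt_compat_l with (r := eps) in H2; [|exact Heps].
    replace (eps * (e / 2 / eps))%R with (e / 2)%R in H2 by (field; lra). lra. }
  destruct (classic (on_edge p r)) as [He|He].
  - assert (H1 := HM p Hp He). assert (H2 := Hmax w Hw). cbv beta in H2. rewrite HGw in H2.
    assert (H3 : (Re (G p) <= A * M)%R).
    { eapply Rle_trans; [apply Rle_abs|]. eapply Rle_trans; [apply re_le_Cmod|].
      unfold G. rewrite Cmod_mult, Cmod_conj. fold A. nra. }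
    assert (H4 : (sqnorm p <= K)%R) by now apply Hq.
    pose proof (Hsq w). nra.
  - destruct (interior_disc p r Hp He) as [rad [Hrad Hdisc]].
    (* As [|z|^2 = |p|^2 + 2 Re(conj(p) (z-p)) + |z-p|^2], the linear term is the real part of a
       holomorphic function and is added to [G]; what remains is the drop [eps rad^2]. *)
    apply (circle_mean_not_below (fun z => G z + (RtoC (2 * eps) * Cconj p) * (z + - p)) p rad (eps * (rad * rad))).
    + exact Hrad.
    + apply Rmult_lt_0_compat; [exact Heps|now apply Rmult_lt_0_compat].
    + intros z Hz. destruct (HG z (Hdisc z Hz)) as [l Hl].
      exists (l + (RtoC (2 * eps) * Cconj p) * (1 + 0)). apply cderiv_plus; [exact Hl|].
      apply (cderiv_scal (fun z => z + - p)), cderiv_plus; [apply cderiv_id|apply cderiv_const].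
    + intros z Hz. assert (H1 := Hmax z (Hdisc z (Req_le _ _ Hz))). cbv beta in H1.
      assert (H2 : sqnorm (z - p) = (rad * rad)%R) by (rewrite sqnorm_Cmod, Hz; ring).
      rewrite <- H2. clear H2 Hz. revert H1.
      destruct (G z) as [u v], (G p) as [u' v'], z as [x y], p as [x0 y0].
      unfold sqnorm, Cconj, RtoC, Cminus, Cplus, Copp, Cmult, Re, Im; simpl. intros H1.
      nra.
Qed.

(** * The identity theorem on the slit plane *)

Definition square (z : C) (l : R) : rect := Rect (Re z - l) (Re z + l) (Im z - l) (Im z + l).

Lemma on_edge_square (z w : C) (l : R) : (0 <= l)%R -> on_edge w (square z l) -> (l <= Cmod (w - z))%R.
Proof.
  intros Hl H. pose proof (re_le_Cmod (w - z)) as H1. pose proof (im_le_Cmod (w - z)) as H2.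
  revert H1 H2. generalize (Cmod (w - z)). intros m H1 H2.
  destruct z as [x y], w as [x' y'].
  unfold on_edge, square, Cminus, Cplus, Copp, Re, Im in *; simpl in *.
  destruct H as [-> | [-> | [-> | ->]]].
  - replace (x - l + - x)%R with (- l)%R in H1 by ring. rewrite Rabs_Ropp, Rabs_pos_eq in H1; lra.
  - replace (x + l + - x)%R with l in H1 by ring. rewrite Rabs_pos_eq in H1; lra.
  - replace (y - l + - y)%R with (- l)%R in H2 by ring. rewrite Rabs_Ropp, Rabs_pos_eq in H2; lra.
  - replace (y + l + - y)%R with l in H2 by ring. rewrite Rabs_pos_eq in H2; lra.
Qed.

Lemma in_square (z w : C) (l : R) : (Cmod (w - z) <= l)%R -> in_rect w (square z l).
Proof.
  intros H. pose proof (re_le_Cmod (w - z)) as H1. pose proof (im_le_Cmod (w - z)) as H2.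
  assert (H1' := Rle_trans _ _ _ H1 H). assert (H2' := Rle_trans _ _ _ H2 H).
  apply Rabs_le_between in H1', H2'. revert H1' H2'.
  destruct z as [x y], w as [x' y'].
  unfold in_rect, square, Cminus, Cplus, Copp, Re, Im in *; simpl in *. lra.
Qed.

(* Since [h] vanishes near [z0], the quotient [h / (z - z0)^N] is holomorphic on the square, and the
   maximum modulus principle gives [|h w| <= M (|w - z0| / l)^N] for every [N]. *)
Lemma vanishing_on_disc (h : C -> C) (z0 : C) (l : R) : (0 < l)%R -> holo_on h (square z0 l) ->
  nearC z0 (fun w => h w = 0) -> forall w, (Cmod (w - z0) < l)%R -> h w = 0.
Proof.
  intros Hl Hh H0 w Hw.
  assert (Hok : rect_ok (square z0 l)) by (unfold rect_ok, square; simpl; lra).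
  destruct (rect_max (fun z => Cmod (h z)) _ Hok) as [q [_ Hq]].
  { intros z Hz eps He. destruct (Hh z Hz) as [k Hk].
    generalize (cderiv_contC _ _ _ Hk eps He). apply nearC_imp. intros v Hv.
    eapply Rle_lt_trans; [|exact Hv]. apply Rabs_le.
    pose proof (Cmod_triangle (h v - h z) (h z)) as T1.
    replace (h v - h z + h z) with (h v) in T1 by ring.
    pose proof (Cmod_triangle (- (h v - h z)) (h v)) as T2.
    replace (- (h v - h z) + h v) with (h z) in T2 by ring.
    rewrite Cmod_opp in T2. lra. }
  set (M := Cmod (h q)) in *. assert (HM : (0 <= M)%R) by apply Cmod_ge_0.
  destruct (classic (w = z0)) as [->|Hne]; [exact (nearC_self _ _ H0)|].
  assert (Hd : (0 < Cmod (w - z0))%R).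
  { apply Cmod_gt_0. intros E. apply Hne. replace w with (w - z0 + z0) by ring. rewrite E. ring. }
  assert (bound : forall N : nat, (Cmod (h w) <= M * (Cmod (w - z0) / l) ^ N)%R).
  { intros N.
    assert (Hb : (Cmod (h w * / ((w + - z0) ^ N)) <= M / l ^ N)%R).
    { apply (maximum_modulus (fun z => h z * / ((z + - z0) ^ N)) (square z0 l)).
      (* Near [z0] the quotient is identically zero, whatever [Cinv] yields at 0, so its derivative
         there is 0. *)
      - intros z Hz. destruct (classic (z = z0)) as [->|Hz0].
        + exists 0. apply cderiv_ext_loc with (f := fun _ => 0); [|apply cderiv_const].
          revert H0. apply nearC_imp. intros v ->. ring.
        + destruct (Hh z Hz) as [k Hk].
          assert (Hs : z + - z0 <> 0).
          { intros E. apply Hz0. replace z with (z + - z0 + z0) by ring. rewrite E. ring. }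
          eexists. apply cderiv_mult; [exact Hk|].
          apply (cderiv_comp Cinv (fun v => (v + - z0) ^ N)); [|apply cderiv_inv, Cpow_nz, Hs].
          apply (cderiv_comp (fun v => v ^ N) (fun v => v + - z0)); [|apply cderiv_pow].
          apply cderiv_plus; [apply cderiv_id|apply cderiv_const].
      - apply in_square. lra.
      - intros z Hz He. pose proof (on_edge_square z0 z l (Rlt_le _ _ Hl) He) as Hz'.
        change (z + - z0) with (z - z0).
        assert (Hz0 : z - z0 <> 0) by (apply Cmod_gt_0; lra).
        rewrite Cmod_mult, Cmod_inv, Cmod_pow by now apply Cpow_nz.
        assert (0 < l ^ N)%R by now apply pow_lt.
        assert (l ^ N <= Cmod (z - z0) ^ N)%R by (apply pow_incr; lra).
        apply Rmult_le_compat; [apply Cmod_ge_0| |now apply Hq|].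
        + left. apply Rinv_0_lt_compat. lra.
        + apply Rinv_le_contravar; lra. }
    change (w + - z0) with (w - z0) in Hb.
    rewrite Cmod_mult, Cmod_inv, Cmod_pow in Hb
      by (apply Cpow_nz, Cmod_gt_0; exact Hd).
    assert (Hp : (0 < Cmod (w - z0) ^ N)%R) by now apply pow_lt.
    apply Rmult_le_compat_r with (r := (Cmod (w - z0) ^ N)%R) in Hb; [|lra].
    rewrite Rmult_assoc, Rinv_l, Rmult_1_r in Hb by lra.
    eapply Rle_trans; [exact Hb|]. right. unfold Rdiv. rewrite Rpow_mult_distr, pow_inv. ring. }
  apply NNPP. intros Hw0. apply Cmod_gt_0 in Hw0.
  assert (Hr : (0 <= Cmod (w - z0) / l < 1)%R).
  { split; [apply Rlt_le, Rdiv_lt_0_compat; lra|].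
    apply Rmult_lt_reg_r with l; [exact Hl|]. unfold Rdiv. rewrite Rmult_assoc, Rinv_l; lra. }
  destruct (pow_lt_1_zero (Cmod (w - z0) / l) ltac:(rewrite Rabs_pos_eq; lra)
    (Cmod (h w) / (M + 1)))%R as [N HN]; [apply Rdiv_lt_0_compat; lra|].
  specialize (HN N (le_n N)). rewrite Rabs_pos_eq in HN by (apply pow_le; lra).
  specialize (bound N).
  assert (0 <= (Cmod (w - z0) / l) ^ N)%R by (apply pow_le; lra).
  apply Rmult_lt_compat_l with (r := (M + 1)%R) in HN; [|lra].
  replace ((M + 1) * (Cmod (h w) / (M + 1)))%R with (Cmod (h w)) in HN by (field; lra). nra.
Qed.

(** The half-side [l] is the same all along the segment, so finitely many steps shorter than [l]
    reach [x]; each lands strictly inside the previous disc, which leaves a neighbourhood on which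
    [h] vanishes. *)
Lemma vanishing_along_segment (h : C -> C) (x : C) (l : R) : (0 < l)%R ->
  (forall t, (0 <= t <= 1)%R -> holo_on h (square (RtoC t * x) l)) ->
  nearC 0 (fun w => h w = 0) -> h x = 0.
Proof.
  intros Hl Hh H0.
  destruct (INR_unbounded (Cmod x / l)) as [n Hn].
  assert (Hn0 : (0 < INR (S n))%R) by apply lt_0_INR, Nat.lt_0_succ.
  assert (Hstep : (Cmod x / INR (S n) < l)%R).
  { apply Rmult_lt_reg_r with (INR (S n)); [exact Hn0|].
    unfold Rdiv. rewrite Rmult_assoc, Rinv_l, Rmult_1_r by lra.
    apply Rmult_lt_compat_r with (r := l) in Hn; [|exact Hl].
    unfold Rdiv in Hn. rewrite Rmult_assoc, Rinv_l, Rmult_1_r in Hn by lra.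
    rewrite S_INR. nra. }
  assert (all : forall j : nat, (j <= S n)%nat ->
    nearC (RtoC (INR j / INR (S n)) * x) (fun w => h w = 0)).
  { induction j as [|j IH]; intros Hj.
    - replace (RtoC (INR 0 / INR (S n)) * x) with (RtoC 0); [exact H0|].
      simpl (INR 0). unfold Rdiv. rewrite Rmult_0_l. ring.
    - assert (Hj' : (0 <= INR j / INR (S n) <= 1)%R).
      { split; [apply Rdiv_le_0_compat; [apply pos_INR|exact Hn0]|].
        apply Rmult_le_reg_r with (INR (S n)); [exact Hn0|].
        unfold Rdiv. rewrite Rmult_assoc, Rinv_l, Rmult_1_r, Rmult_1_l by lra. apply le_INR. lia. }
      pose proof (vanishing_on_disc h _ l Hl (Hh _ Hj') (IH ltac:(lia))) as HV.
      set (z0 := RtoC (INR j / INR (S n)) * x) in *.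
      set (z1 := RtoC (INR (S j) / INR (S n)) * x).
      assert (E : z1 - z0 = RtoC (/ INR (S n)) * x).
      { unfold z1, z0. rewrite (S_INR j).
        replace ((INR j + 1) / INR (S n))%R with (INR j / INR (S n) + / INR (S n))%R by (field; lra).
        rewrite RtoC_plus. ring. }
      assert (D : (Cmod (z1 - z0) < l)%R).
      { rewrite E, Cmod_mult, Cmod_R, Rabs_pos_eq by (left; now apply Rinv_0_lt_compat).
        rewrite Rmult_comm. exact Hstep. }
      exists (l - Cmod (z1 - z0))%R. split; [lra|]. intros w Hw. apply HV.
      replace (w - z0) with ((w - z1) + (z1 - z0)) by ring.
      eapply Rle_lt_trans; [apply Cmod_triangle|]. lra. }
  pose proof (nearC_self _ _ (all (S n) (le_n _))) as Hx. cbv beta in Hx.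
  unfold Rdiv in Hx. rewrite Rinv_r in Hx by lra. rewrite Cmult_1_l in Hx. exact Hx.
Qed.

(** The slit plane is star-shaped about 0, so the segment to [x] stays in it; the margin is explicit
    instead of being drawn from compactness. *)
Lemma slit_segment_margin (x : C) : slit x -> exists l : R, (0 < l)%R /\
  forall t z, (0 <= t <= 1)%R -> in_rect z (square (RtoC t * x) l) -> slit z.
Proof.
  intros Hx. destruct x as [a b]. unfold slit, in_rect, square, Re, Im in *; simpl in *.
  destruct (Req_dec b 0) as [->|Hb].
  - assert (Ha : (a < 1)%R) by (apply Rnot_le_lt; intros H; now apply Hx).
    exists (Rmin ((1 - a) / 2) (1 / 2)). split; [apply Rmin_glb_lt; lra|].
    intros t [u v] Ht Hz [H1 H2]. simpl in *.
    pose proof (Rmin_l ((1 - a) / 2) (1 / 2)). pose proof (Rmin_r ((1 - a) / 2) (1 / 2)).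
    destruct (Rle_lt_dec a 0); [assert (t * a <= 0)%R by nra|assert (t * a <= a)%R by nra]; lra.
  (* A point of the cut inside the square would force [t s >= 3/4] through its real part, but
     [t |b| <= l <= |b| / (4 s)], that is [t s <= 1/4], through its imaginary part. *)
  - set (s := (Rabs a + 1)%R). assert (Hs : (1 <= s)%R) by (unfold s; pose proof (Rabs_pos a); lra).
    pose proof (Rabs_pos_lt b Hb) as Hb'.
    exists (Rmin (Rabs b / (4 * s)) (1 / 4)). split.
    { apply Rmin_glb_lt; [|lra]. apply Rdiv_lt_0_compat; lra. }
    intros t [u v] Ht Hz [H1 H2]. simpl in *.
    pose proof (Rmin_l (Rabs b / (4 * s)) (1 / 4)) as L1. pose proof (Rmin_r (Rabs b / (4 * s)) (1 / 4)) as L2.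
    set (l := Rmin _ _) in *.
    assert (Hta : (t * a <= t * s)%R) by (apply Rmult_le_compat_l; [lra|]; unfold s; pose proof (Rle_abs a); lra).
    assert (Hts : (3 / 4 <= t * s)%R) by lra.
    assert (Htb : (Rabs (t * b) <= l)%R) by (apply Rabs_le; lra).
    rewrite Rabs_mult, Rabs_pos_eq in Htb by lra.
    assert (Hq : (Rabs b / (4 * s) * s = Rabs b / 4)%R) by (field; lra).
    assert (t * Rabs b * s <= Rabs b / (4 * s) * s)%R by (apply Rmult_le_compat_r; lra).
    nra.
Qed.

Theorem slit_identity (h : C -> C) (x : C) :
  (forall z, slit z -> exists l, cderiv h z l) -> nearC 0 (fun w => h w = 0) -> slit x -> h x = 0.
Proof.
  intros Hh H0 Hx. destruct (slit_segment_margin x Hx) as [l [Hl Hs]].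
  apply (vanishing_along_segment h x l Hl); [|exact H0].
  intros t Ht z Hz. apply Hh. now apply (Hs t).
Qed.

(** * Series *)

Definition sums_to (u : nat -> C) (l : C) : Prop :=
  forall eps : R, (0 < eps)%R ->
    exists N, forall n, (N <= n)%nat -> (Cmod (sumC n u - l) < eps)%R.

Lemma sum_n_sumC (u : nat -> C) (n : nat) : sum_n u n = sumC n u.
Proof.
  induction n as [|n IH]; [apply sum_O|]. rewrite sum_Sn, IH. reflexivity.
Qed.

Lemma hyp_series_sums_to (A B : list C) (g : C -> C) (z : C) :
  is_pFq A B g -> (Cmod z < 1)%R -> sums_to (hyp_term A B z) (g z).
Proof.
  intros [_ H] Hz eps He. specialize (H z Hz).
  destruct (H (fun w => (Cmod (w - g z) < eps)%R)) as [N HN].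
  - apply (locally_le_locally_norm (g z)). exists (mkposreal eps He). intros w Hw. exact Hw.
  - exists N. intros n Hn. specialize (HN n Hn). now rewrite sum_n_sumC in HN.
Qed.

Lemma sums_to_unique (u : nat -> C) (l k : C) : sums_to u l -> sums_to u k -> l = k.
Proof.
  intros Hl Hk. apply NNPP. intros H.
  assert (Hd : (0 < Cmod (l - k))%R).
  { apply Cmod_gt_0. intros E. apply H. replace l with (l - k + k) by ring. rewrite E. ring. }
  destruct (Hl (Cmod (l - k) / 2)%R ltac:(lra)) as [N1 H1].
  destruct (Hk (Cmod (l - k) / 2)%R ltac:(lra)) as [N2 H2].
  specialize (H1 (max N1 N2) (Nat.le_max_l _ _)). specialize (H2 (max N1 N2) (Nat.le_max_r _ _)).
  set (S := sumC (max N1 N2) u) in *.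
  pose proof (Cmod_triangle (- (S - l)) (S - k)) as T. rewrite Cmod_opp in T.
  replace (- (S - l) + (S - k)) with (l - k) in T by ring. lra.
Qed.

Lemma sums_to_ext (u v : nat -> C) (l : C) : (forall n, u n = v n) -> sums_to u l -> sums_to v l.
Proof.
  intros E H eps He. destruct (H eps He) as [N HN]. exists N. intros n Hn.
  rewrite <- (sumC_ext n u v) by auto. now apply HN.
Qed.

Lemma sums_to_bounded (u : nat -> C) (l : C) :
  sums_to u l -> exists A, (0 <= A)%R /\ forall n, (Cmod (u n) <= A)%R.
Proof.
  intros H. destruct (H 1%R Rlt_0_1) as [N HN].
  assert (Hfin : forall k, exists A, (0 <= A)%R /\ forall n, (n < k)%nat -> (Cmod (u n) <= A)%R).
  { induction k as [|k [A [HA IH]]].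
    - exists 0%R. split; [lra|]. intros n Hn. lia.
    - exists (Rmax A (Cmod (u k))). pose proof (Rmax_l A (Cmod (u k))). pose proof (Rmax_r A (Cmod (u k))).
      split; [lra|]. intros n Hn. destruct (Nat.eq_dec n k) as [->|Hk]; [assumption|].
      specialize (IH n ltac:(lia)). lra. }
  (* Beyond [N] a term is the difference of two partial sums within 1 of the limit, hence at most
     2. *)
  destruct (Hfin (S N)) as [A [HA HA']]. exists (Rmax A 2).
  pose proof (Rmax_l A 2). pose proof (Rmax_r A 2). split; [lra|]. intros n.
  destruct (Nat.lt_ge_cases n (S N)) as [Hn|Hn]; [specialize (HA' n Hn); lra|].
  destruct n as [|n]; [lia|].
  pose proof (HN n ltac:(lia)) as T1. pose proof (HN (S n) ltac:(lia)) as T2. simpl in T2.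
  pose proof (Cmod_triangle (sumC n u + u (S n) - l) (- (sumC n u - l))) as T. rewrite Cmod_opp in T.
  replace (sumC n u + u (S n) - l + - (sumC n u - l)) with (u (S n)) in T by ring. lra.
Qed.

Lemma S_le_pow2 (n : nat) : (INR (S n) <= 2 ^ n)%R.
Proof.
  induction n as [|n IH]; [simpl; lra|].
  rewrite S_INR. simpl pow. pose proof (pow_R1_Rle 2 n ltac:(lra)). lra.
Qed.

Lemma Cmod_sumC_le (N : nat) (u : nat -> C) (M : R) :
  (forall k, (k <= N)%nat -> (Cmod (u k) <= M)%R) -> (Cmod (sumC N u) <= INR (S N) * M)%R.
Proof.
  induction N as [|N IH]; intros H.
  - simpl sumC. specialize (H O (le_n _)). simpl INR. lra.
  - simpl sumC. rewrite S_INR. eapply Rle_trans; [apply Cmod_triangle|].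
    pose proof (IH (fun k Hk => H k (le_S _ _ Hk))). pose proof (H (S N) (le_n _)). lra.
Qed.

(** The telescoping bound closes the induction because [(/ 4)^(N+1)] is at most
    [(/ 4)^N - (/ 4)^(N+1)]. *)
Lemma sumC_tail_le (u : nat -> C) (A : R) (M N : nat) : (0 <= A)%R -> (M <= N)%nat ->
  (forall n, (Cmod (u n) <= A * (/ 4) ^ n)%R) ->
  (Cmod (sumC N u - sumC M u) <= A * ((/ 4) ^ M - (/ 4) ^ N))%R.
Proof.
  intros HA HMN Hu. induction HMN as [|N HMN IH].
  - replace (sumC M u - sumC M u) with (RtoC 0) by ring. rewrite Cmod_0. lra.
  - simpl sumC. replace (sumC N u + u (S N) - sumC M u) with ((sumC N u - sumC M u) + u (S N)) by ring.
    eapply Rle_trans; [apply Cmod_triangle|]. specialize (Hu (S N)). simpl pow in *.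
    assert (0 <= A * (/ 4) ^ N)%R by (apply Rmult_le_pos; [|apply pow_le]; lra). lra.
Qed.

Definition convolution (u v : nat -> C) (n : nat) : C := sumC n (fun i => u i * v (n - i)%nat).

Lemma cauchy_product_swap (u v : nat -> C) (N : nat) :
  sumC N (convolution u v) =
  sumC N (fun i => u i * sumC (N - i) v).
Proof.
  induction N as [|N IH]; [reflexivity|].
  change (sumC N (convolution u v) +
          (sumC N (fun i => u i * v (S N - i)%nat) + u (S N) * v (S N - S N)%nat) =
          sumC N (fun i => u i * sumC (S N - i) v) + u (S N) * sumC (S N - S N) v).
  rewrite IH, Nat.sub_diag, Cplus_assoc, <- sumC_plus. simpl (sumC 0 v). f_equal.
  apply sumC_ext. intros i Hi. rewrite Nat.sub_succ_l by exact Hi. simpl sumC. ring.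
Qed.

(** The product of the partial sums differs from the partial sum of the convolution by [N + 1] terms
    of size at most [A B (/ 4)^N]; since [N + 1 <= 2^N], the ratio 1/4 leaves the null sequence
    [A B (/ 2)^N]. *)
Lemma cauchy_product (u v : nat -> C) (l k : C) (A B : R) :
  sums_to u l -> sums_to v k -> (0 <= A)%R -> (0 <= B)%R ->
  (forall n, (Cmod (u n) <= A * (/ 4) ^ n)%R) -> (forall n, (Cmod (v n) <= B * (/ 4) ^ n)%R) ->
  sums_to (convolution u v) (l * k).
Proof.
  intros Hl Hk HA HB Hu Hv eps He.
  assert (Hdiff : forall N, (Cmod (sumC N u * sumC N v - sumC N (convolution u v)) <= A * B * (/ 2) ^ N)%R).
  { intros N. rewrite cauchy_product_swap.
    replace (sumC N u * sumC N v - sumC N (fun i => u i * sumC (N - i) v))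
      with (sumC N (fun i => u i * (sumC N v - sumC (N - i) v))).
    - eapply Rle_trans; [apply Cmod_sumC_le with (M := (A * B * (/ 4) ^ N)%R)|].
      + intros i Hi. rewrite Cmod_mult.
        assert (H : (Cmod (sumC N v - sumC (N - i) v) <= B * (/ 4) ^ (N - i))%R).
        { eapply Rle_trans; [apply (sumC_tail_le v B (N - i) N HB); [lia|exact Hv]|].
          apply Rmult_le_compat_l; [exact HB|]. assert (0 <= (/ 4) ^ N)%R by (apply pow_le; lra). lra. }
        eapply Rle_trans; [apply Rmult_le_compat; [apply Cmod_ge_0|apply Cmod_ge_0|apply Hu|exact H]|].
        right. replace ((/ 4) ^ N)%R with ((/ 4) ^ i * (/ 4) ^ (N - i))%R; [ring|].
        rewrite <- pow_add. f_equal. lia.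
      + pose proof (S_le_pow2 N) as H.
        replace ((/ 2) ^ N)%R with (2 ^ N * (/ 4) ^ N)%R
          by (rewrite <- Rpow_mult_distr; f_equal; field).
        assert (0 <= A * B * (/ 4) ^ N)%R by (repeat apply Rmult_le_pos; auto; apply pow_le; lra).
        apply Rmult_le_compat_r with (r := (A * B * (/ 4) ^ N)%R) in H; [|assumption]. lra.
    - transitivity (sumC N v * sumC N u + (- (1)) * sumC N (fun i => u i * sumC (N - i) v)); [|ring].
      rewrite <- !sumC_scal, <- sumC_plus. apply sumC_ext. intros; ring. }
  assert (Hprod : exists N, forall n, (N <= n)%nat -> (Cmod (sumC n u * sumC n v - l * k) < eps / 2)%R).
  { set (s := (Cmod l + Cmod k + 1)%R). pose proof (Cmod_ge_0 l). pose proof (Cmod_ge_0 k).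
    set (e := Rmin 1 (eps / (4 * s))).
    assert (Hs : (0 < 4 * s)%R) by (unfold s; lra).
    assert (Hq : (0 < eps / (4 * s))%R) by now apply Rdiv_lt_0_compat.
    assert (Hee : (0 < e)%R) by (apply Rmin_glb_lt; lra).
    assert (He1 : (e <= 1)%R) by apply Rmin_l.
    assert (He2 : (e * (4 * s) <= eps)%R).
    { replace eps with (eps / (4 * s) * (4 * s))%R by (field; lra).
      apply Rmult_le_compat_r; [lra|apply Rmin_r]. }
    destruct (Hl e Hee) as [N1 H1]. destruct (Hk e Hee) as [N2 H2]. exists (max N1 N2).
    intros n Hn. specialize (H1 n ltac:(lia)). specialize (H2 n ltac:(lia)).
    set (p := sumC n u - l) in *. set (q := sumC n v - k) in *.
    replace (sumC n u * sumC n v - l * k) with (p * q + (p * k + l * q)) by (unfold p, q; ring).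
    eapply Rle_lt_trans; [apply Cmod_triangle|].
    eapply Rle_lt_trans; [apply Rplus_le_compat_l, Cmod_triangle|]. rewrite !Cmod_mult.
    pose proof (Cmod_ge_0 p). pose proof (Cmod_ge_0 q).
    assert (Cmod p * Cmod q <= e * 1)%R by (apply Rmult_le_compat; lra).
    assert (Cmod p * Cmod k <= e * Cmod k)%R by (apply Rmult_le_compat_r; lra).
    assert (Cmod l * Cmod q <= Cmod l * e)%R by (apply Rmult_le_compat_l; lra).
    assert (0 < e * s)%R by (apply Rmult_lt_0_compat; lra).
    assert (e * s = e * 1 + (e * Cmod k + Cmod l * e))%R by (unfold s; ring). lra. }
  destruct Hprod as [N1 H1].
  destruct (exists_half_pow_lt (A * B) (eps / 2) ltac:(now apply Rmult_le_pos) ltac:(lra)) as [N2 H2].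
  exists (max N1 N2). intros n Hn. specialize (H1 n ltac:(lia)). specialize (Hdiff n).
  assert (H3 : (A * B * (/ 2) ^ n <= A * B * (/ 2) ^ N2)%R).
  { apply Rmult_le_compat_l; [now apply Rmult_le_pos|].
    replace n with (N2 + (n - N2))%nat by lia. rewrite pow_add.
    rewrite <- (Rmult_1_r ((/ 2) ^ N2)) at 2. apply Rmult_le_compat_l; [apply pow_le; lra|].
    rewrite <- (pow1 (n - N2)). apply pow_incr. lra. }
  set (c := sumC n (convolution u v)) in *.
  replace (c - l * k) with (- (sumC n u * sumC n v - c) + (sumC n u * sumC n v - l * k)) by ring.
  eapply Rle_lt_trans; [apply Cmod_triangle|]. rewrite Cmod_opp. lra.
Qed.

Lemma cderiv_ray (f : C -> C) (z : C) (t : R) (l : C) : cderiv f (RtoC t * z) l ->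
  is_derive (fun t => Re (f (RtoC t * z))) t (Re (l * z)) /\
  is_derive (fun t => Im (f (RtoC t * z))) t (Im (l * z)).
Proof.
  intros H.
  assert (Hb : forall eps, (0 < eps)%R -> exists d : posreal, forall h, h <> 0%R -> (Rabs h < d)%R ->
    (Cmod (f (RtoC (t + h) * z)%C - f (RtoC t * z)%C - RtoC h * (l * z)) < eps * Rabs h)%R).
  { intros eps He. pose proof (Cmod_ge_0 z) as Hz.
    assert (Hs : (0 < Cmod z + 1)%R) by lra.
    assert (He' : (0 < eps / (2 * (Cmod z + 1)))%R) by (apply Rdiv_lt_0_compat; lra).
    destruct (H _ He') as [d [Hd HD]].
    assert (Hd' : (0 < d / (Cmod z + 1))%R) by now apply Rdiv_lt_0_compat.
    exists (mkposreal _ Hd'). simpl. intros h Hh0 Hh.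
    pose proof (Rabs_pos_lt h Hh0) as Hh1.
    assert (E : RtoC (t + h) * z - RtoC t * z = RtoC h * z) by (rewrite RtoC_plus; ring).
    specialize (HD (RtoC (t + h) * z)). rewrite E in HD. rewrite Cmod_mult, Cmod_R in HD.
    assert (Hlt : (Rabs h * Cmod z < d)%R).
    { apply Rmult_lt_compat_r with (r := (Cmod z + 1)%R) in Hh; [|exact Hs].
      unfold Rdiv in Hh. rewrite Rmult_assoc, Rinv_l, Rmult_1_r in Hh by lra. lra. }
    specialize (HD Hlt).
    replace (RtoC h * (l * z)) with (l * (RtoC h * z)) by ring.
    eapply Rle_lt_trans; [exact HD|].
    assert (Ez : (eps / (2 * (Cmod z + 1)) * (Rabs h * (Cmod z + 1)) = eps / 2 * Rabs h)%R) by (field; lra).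
    assert (eps / (2 * (Cmod z + 1)) * (Rabs h * Cmod z) <=
            eps / (2 * (Cmod z + 1)) * (Rabs h * (Cmod z + 1)))%R
      by (apply Rmult_le_compat_l; lra).
    assert (0 < eps * Rabs h)%R by now apply Rmult_lt_0_compat. lra. }
  split; apply is_derive_Reals; intros eps He; destruct (Hb eps He) as [d Hd];
    exists d; intros h Hh0 Hh; specialize (Hd h Hh0 Hh);
    pose proof (Rabs_pos_lt h Hh0) as Hh1;
    apply Rmult_lt_reg_r with (Rabs h); try exact Hh1; rewrite <- Rabs_mult;
    (eapply Rle_lt_trans; [|exact Hd]).
  - eapply Rle_trans; [|apply re_le_Cmod]. right. f_equal.
    transitivity (Re (f (RtoC (t + h) * z)%C) - Re (f (RtoC t * z)%C) - h * Re (l * z)%C)%R; [field; exact Hh0|].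
    generalize (l * z) (f (RtoC (t + h) * z)) (f (RtoC t * z)).
    intros [p1 p2] [q1 q2] [r1 r2]. unfold Cminus, Cplus, Copp, Cmult, RtoC, Re; simpl. ring.
  - eapply Rle_trans; [|apply im_le_Cmod]. right. f_equal.
    transitivity (Im (f (RtoC (t + h) * z)%C) - Im (f (RtoC t * z)%C) - h * Im (l * z)%C)%R; [field; exact Hh0|].
    generalize (l * z) (f (RtoC (t + h) * z)) (f (RtoC t * z)).
    intros [p1 p2] [q1 q2] [r1 r2]. unfold Cminus, Cplus, Copp, Cmult, RtoC, Im; simpl. ring.
Qed.

(** The real mean value bound is applied to the real and imaginary parts along the segment from 0;
    adding the two costs the factor 2. *)
Lemma mean_value_ineq (f df : C -> C) (z : C) (D : R) :
  (forall w, (Cmod w <= Cmod z)%R -> cderiv f w (df w) /\ (Cmod (df w) <= D)%R) ->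
  (Cmod (f z - f 0) <= 2 * (D * Cmod z))%R.
Proof.
  intros H.
  assert (Hray : forall t, (Rabs (t - 0) <= Rabs (1 - 0))%R -> (Cmod (RtoC t * z) <= Cmod z)%R).
  { intros t Ht. rewrite Cmod_mult, Cmod_R. rewrite !Rminus_0_r, Rabs_R1 in Ht.
    pose proof (Cmod_ge_0 z). rewrite <- (Rmult_1_l (Cmod z)) at 2. now apply Rmult_le_compat_r. }
  assert (HB : forall t, (Rabs (t - 0) <= Rabs (1 - 0))%R -> (Cmod (df (RtoC t * z)%C * z) <= D * Cmod z)%R).
  { intros t Ht. rewrite Cmod_mult. apply Rmult_le_compat_r; [apply Cmod_ge_0|]. apply H, Hray, Ht. }
  assert (B1 : (Rabs (Re (f (RtoC 1 * z)%C) - Re (f (RtoC 0 * z)%C)) <= D * Cmod z * Rabs (1 - 0))%R).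
  { apply (bounded_variation (fun t => Re (f (RtoC t * z))) (fun t => Re (df (RtoC t * z) * z))).
    intros t Ht. split.
    - apply (cderiv_ray f z t (df (RtoC t * z))). apply H, Hray, Ht.
    - eapply Rle_trans; [apply re_le_Cmod|now apply HB]. }
  assert (B2 : (Rabs (Im (f (RtoC 1 * z)%C) - Im (f (RtoC 0 * z)%C)) <= D * Cmod z * Rabs (1 - 0))%R).
  { apply (bounded_variation (fun t => Im (f (RtoC t * z))) (fun t => Im (df (RtoC t * z) * z))).
    intros t Ht. split.
    - apply (cderiv_ray f z t (df (RtoC t * z))). apply H, Hray, Ht.
    - eapply Rle_trans; [apply im_le_Cmod|now apply HB]. }
  rewrite Rminus_0_r, Rabs_R1, Cmult_1_l, Cmult_0_l in B1, B2.
  eapply Rle_trans; [apply Cmod_le_abs|]. unfold Rminus in B1, B2.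
  unfold Cminus, Cplus, Copp. unfold Re at 1, Im at 1; simpl.
  unfold Re, Im in *. lra.
Qed.

(** * The binomial series and the transformation *)

(** Taylor coefficients of [(1-z)^(-s)]; the rising factorial absorbs the alternating sign of the
    usual binomial coefficients. *)
Definition binom_coeff (s : C) (n : nat) : C := poch s n / # (fact n).

Lemma binom_coeff_S (s : C) (n : nat) : # (S n) * binom_coeff s (S n) = (s + # n) * binom_coeff s n.
Proof.
  unfold binom_coeff. rewrite fact_S_C. simpl poch. field.
  split; [apply fact_neq_0_C|now apply nC_neq_0].
Qed.

(** The recursion multiplies by [(s+n)/(n+1)], of modulus at most [|s| + 1]. This crude bound
    suffices because only a neighbourhood of 0 matters. *)
Lemma binom_coeff_le (s : C) (n : nat) : (Cmod (binom_coeff s n) <= (Cmod s + 1) ^ n)%R.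
Proof.
  pose proof (Cmod_ge_0 s) as Hs.
  induction n as [|n IH].
  - unfold binom_coeff. simpl. replace (1 / 1) with (RtoC 1) by field. rewrite Cmod_1. lra.
  - assert (Hn : (0 < INR (S n))%R) by apply lt_0_INR, Nat.lt_0_succ.
    assert (E : (INR (S n) * Cmod (binom_coeff s (S n)) = Cmod (s + # n) * Cmod (binom_coeff s n))%R).
    { rewrite <- Cmod_mult, <- binom_coeff_S, Cmod_mult, Cmod_R, Rabs_pos_eq; lra. }
    apply Rmult_le_reg_l with (INR (S n)); [exact Hn|]. rewrite E. simpl pow.
    rewrite <- Rmult_assoc. apply Rmult_le_compat; [apply Cmod_ge_0|apply Cmod_ge_0| |exact IH].
    eapply Rle_trans; [apply Cmod_triangle|]. rewrite Cmod_R, Rabs_pos_eq by apply pos_INR.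
    rewrite S_INR. pose proof (pos_INR n). nra.
Qed.

Definition binom_poly (s : C) (N : nat) (z : C) : C := sumC N (fun k => binom_coeff s k * z ^ k).
Definition binom_poly' (s : C) (N : nat) (z : C) : C :=
  sumC N (fun k => binom_coeff s k * (# k * z ^ pred k)).

Lemma cderiv_binom_poly (s : C) (N : nat) (z : C) : cderiv (binom_poly s N) z (binom_poly' s N z).
Proof.
  induction N as [|N IH].
  - exact (cderiv_scal _ _ _ _ (cderiv_pow z 0)).
  - exact (cderiv_plus _ _ _ _ _ IH (cderiv_scal _ _ _ _ (cderiv_pow z (S N)))).
Qed.

(** The equation [(1-z) y' = s y] is that of [(1-z)^(-s)]; the coefficient recursion telescopes, so
    a partial sum misses it by a single term. *)
Lemma binom_poly_ode (s : C) (N : nat) (z : C) :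
  (1 - z) * binom_poly' s N z - s * binom_poly s N z = - (# (S N) * binom_coeff s (S N) * z ^ N).
Proof.
  induction N as [|N IH].
  - rewrite binom_coeff_S. unfold binom_poly', binom_poly, binom_coeff. simpl. field.
  - change (binom_poly' s (S N) z)
      with (binom_poly' s N z + binom_coeff s (S N) * (# (S N) * z ^ N)).
    change (binom_poly s (S N) z) with (binom_poly s N z + binom_coeff s (S N) * z ^ S N).
    transitivity (((1 - z) * binom_poly' s N z - s * binom_poly s N z) +
      ((1 - z) * (binom_coeff s (S N) * (# (S N) * z ^ N)) - s * (binom_coeff s (S N) * z ^ S N))); [ring|].
    rewrite IH, (binom_coeff_S s (S N)), Cpow_S. ring.
Qed.

Lemma slit_near_0 (z : C) : (Cmod z < 1)%R -> slit z.
Proof.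
  intros H [_ H1]. pose proof (re_le_Cmod z). pose proof (Rle_abs (Re z)). lra.
Qed.

(* [(1 - z)^s] times the N-th partial sum has, by [binom_poly_ode], a derivative that is
   geometrically small in N, so it tends to its value 1 at the origin. *)
Lemma binomial_series (s : C) :
  nearC 0 (fun z => sums_to (fun n => binom_coeff s n * z ^ n) (Cpow_principal (1 - z) (- s))).
Proof.
  set (K := (Cmod s + 1)%R).
  assert (HK : (1 <= K)%R) by (unfold K; pose proof (Cmod_ge_0 s); lra).
  (* This is [(1-z)^(s-1)]: the derivative of [(1-z)^s] times a partial sum is [g] times the defect
     in [binom_poly_ode]. *)
  set (g := fun z => Cpow_principal (1 - z) s * / (1 - z)).
  assert (Hg : exists l, cderiv g 0 l).
  { assert (S0 : slit 0) by (apply slit_near_0; rewrite Cmod_0; lra).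
    eexists. apply cderiv_mult; [now apply cderiv_Cpow_1_minus|].
    apply (cderiv_comp Cinv (fun z => 1 - z)); [|apply cderiv_inv, slit_neq_1, S0].
    apply cderiv_ext_loc with (f := fun w => 1 + - (1) * w); [apply nearC_all; intros; ring|].
    apply cderiv_plus; [apply cderiv_const|]. apply cderiv_scal, cderiv_id. }
  destruct Hg as [l Hg]. pose proof (contC_bounded _ _ (cderiv_contC _ _ _ Hg)) as HB.
  set (D := (Cmod (g 0) + 1)%R) in *. assert (HD : (0 <= D)%R) by (unfold D; pose proof (Cmod_ge_0 (g 0)); lra).
  destruct HB as [d [Hd HB]].
  assert (HK4 : (0 < / (4 * K) <= / 4)%R).
  { split; [apply Rinv_0_lt_compat; lra|apply Rinv_le_contravar; lra]. }
  (* Within [1/(4K)] the modulus of the defect is at most [2^N K^(N+1) (4K)^(-N) = K 2^(-N)], where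
     [2^N] bounds [N + 1]. *)
  exists (Rmin d (/ (4 * K))). split; [apply Rmin_glb_lt; lra|].
  intros z Hz. replace (z - 0) with z in Hz by ring.
  pose proof (Rmin_l d (/ (4 * K))) as M1. pose proof (Rmin_r d (/ (4 * K))) as M2.
  set (W := fun N w => binom_poly s N w * Cpow_principal (1 - w) s).
  assert (HW : forall N, (Cmod (W N z - 1) <= 2 * (D * (K * (/ 2) ^ N) * Cmod z))%R).
  { intros N.
    assert (W0 : W N 0 = 1).
    { unfold W. replace (1 - 0) with (RtoC 1) by ring. rewrite Cpow_principal_1, Cmult_1_r.
      induction N as [|N IH]; unfold binom_poly in *; simpl.
      - unfold binom_coeff. simpl. field.
      - rewrite IH. ring. }
    rewrite <- W0.
    apply (mean_value_ineq (W N) (fun w => - (# (S N) * binom_coeff s (S N) * w ^ N) * g w)).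
    intros w Hw.
    assert (Hw4 : (Cmod w <= / (4 * K))%R) by lra.
    assert (Sw : slit w) by (apply slit_near_0; lra).
    split.
    - replace (- (# (S N) * binom_coeff s (S N) * w ^ N) * g w)
        with (binom_poly' s N w * Cpow_principal (1 - w) s +
              binom_poly s N w * (- s / (1 - w) * Cpow_principal (1 - w) s)).
      + exact (cderiv_mult _ _ _ _ _ (cderiv_binom_poly s N w) (cderiv_Cpow_1_minus s w Sw)).
      + rewrite <- binom_poly_ode. unfold g. field. now apply slit_neq_1.
    - rewrite Cmod_mult, Rmult_comm.
      apply Rmult_le_compat; [apply Cmod_ge_0|apply Cmod_ge_0| |].
      + apply HB. replace (w - 0) with w by ring. lra.
      + rewrite Cmod_opp, !Cmod_mult, Cmod_R, Rabs_pos_eq by apply pos_INR. rewrite Cmod_pow.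
        assert (P1 : (Cmod w ^ N <= / (4 * K) ^ N)%R).
        { rewrite <- pow_inv. apply pow_incr. split; [apply Cmod_ge_0|exact Hw4]. }
        eapply Rle_trans.
        * apply Rmult_le_compat; [| |apply Rmult_le_compat; [| |apply S_le_pow2|apply binom_coeff_le]|exact P1].
          -- apply Rmult_le_pos; [apply pos_INR|apply Cmod_ge_0].
          -- apply pow_le, Cmod_ge_0.
          -- apply pos_INR.
          -- apply Cmod_ge_0.
        * fold K. right. rewrite Rpow_mult_distr. simpl pow.
          replace 4%R with (2 * 2)%R by ring. rewrite Rpow_mult_distr, pow_inv. field.
          split; apply pow_nonzero; lra. }
  intros eps He.
  set (P := Cpow_principal (1 - z) (- s)).
  pose proof (Cmod_ge_0 P) as HP. pose proof (Cmod_ge_0 z) as Hz0.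
  destruct (exists_half_pow_lt (2 * (D * K * Cmod z) * Cmod P) eps) as [N HN].
  { repeat apply Rmult_le_pos; lra. }
  { exact He. }
  exists N. intros n Hn. fold (binom_poly s n z).
  replace (binom_poly s n z - P) with ((W n z - 1) * P).
  - rewrite Cmod_mult. eapply Rle_lt_trans; [apply Rmult_le_compat_r; [exact HP|apply HW]|].
    eapply Rle_lt_trans; [|exact HN].
    assert (Hpow : ((/ 2) ^ n <= (/ 2) ^ N)%R).
    { replace n with (N + (n - N))%nat by lia. rewrite pow_add.
      rewrite <- (Rmult_1_r ((/ 2) ^ N)) at 2. apply Rmult_le_compat_l; [apply pow_le; lra|].
      rewrite <- (pow1 (n - N)). apply pow_incr. lra. }
    apply Rle_trans with (2 * (D * K * Cmod z) * Cmod P * (/ 2) ^ n)%R; [right; ring|].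
    apply Rmult_le_compat_l; [|exact Hpow]. repeat apply Rmult_le_pos; lra.
  - unfold W, P. transitivity (binom_poly s n z *
      (Cpow_principal (1 - z) s * Cpow_principal (1 - z) (- s)) - Cpow_principal (1 - z) (- s)); [ring|].
    rewrite Cpow_principal_opp. ring.
Qed.

(** * Series coefficients from the roots of [Phat] *)

Lemma poch_prod_shift1 (eta : list C) (n : nat) :
  poch_prod (map (fun e => e + 1) eta) n * prodC eta =
  poch_prod eta n * prodC (map (fun e => e + # n) eta).
Proof.
  induction eta as [|e eta IH]; [reflexivity|].
  change (poch (e + 1) n * poch_prod (map (fun e => e + 1) eta) n * (e * prodC eta) =
    poch e n * poch_prod eta n * ((e + # n) * prodC (map (fun e => e + # n) eta))).
  transitivity ((e * poch (e + 1) n) * (poch_prod (map (fun e => e + 1) eta) n * prodC eta)); [ring|].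
  rewrite IH, <- poch_Sl. simpl poch. ring.
Qed.

Lemma prodC_roots_at_neg (eta : list C) (n : nat) :
  prodC (map (fun e => - # n - e) eta) = (- (1)) ^ length eta * prodC (map (fun e => e + # n) eta).
Proof.
  induction eta as [|e eta IH]; [simpl; ring|].
  change ((- # n - e) * prodC (map (fun e => - # n - e) eta) =
    - (1) * (- (1)) ^ length eta * ((e + # n) * prodC (map (fun e => e + # n) eta))).
  rewrite IH. ring.
Qed.

Lemma Phat_0 (fs : list C) (ms : list nat) (a b c : C) :
  let m := list_sum ms in
  length ms = length fs ->
  poch (c - a - # m) m <> 0 -> poch (c - b - # m) m <> 0 ->
  (forall f, In f fs -> not_nonpos_int f) ->
  (forall k, (k <= m)%nat -> forall n, (n <= k)%nat -> poch (b + # m - # k + 1) n <> 0) ->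
  Phat fs ms a b c (- # 0) = 1.
Proof.
  intros m Hl Ha Hb Hf Hbk. pose proof (Phat_neg_nat fs ms a b c 0 Hl Ha Hb Hf Hbk) as H.
  fold m in H. simpl poch in H. rewrite !Cmult_1_l in H. rewrite H.
  assert (one : forall l, poch_prod l 0 = 1).
  { induction l as [|e l IH]; [reflexivity|].
    change (1 * poch_prod l 0 = 1). rewrite IH. ring. }
  unfold transf_coeff, binom_diff. simpl. rewrite !one. field.
Qed.

(** Both sides are the product of [(e+n)/e] over the roots: on the left because
    [e (e+1)_n = (e)_n (e+n)], on the right because the value 1 at the origin eliminates the unknown
    factor [lam]. *)
Lemma roots_ratio (eta : list C) (P : C -> C) (lam : C) (n : nat) :
  (forall t, P t = lam * prodC (map (fun e => t - e) eta)) -> P (- # 0) = 1 ->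
  (forall e, In e eta -> not_nonpos_int e) ->
  poch_prod (map (fun e => e + 1) eta) n / poch_prod eta n = P (- # n).
Proof.
  intros HP H0 He. pose proof (poch_prod_neq_0 eta n He) as Hn.
  rewrite HP, prodC_roots_at_neg in H0. rewrite HP, prodC_roots_at_neg.
  replace (map (fun e => e + # 0) eta) with eta in H0.
  2:{ rewrite <- (map_id eta) at 1. apply map_ext. intros e. simpl (# 0). ring. }
  transitivity (lam * ((- (1)) ^ length eta * prodC eta) *
    poch_prod (map (fun e => e + 1) eta) n / poch_prod eta n).
  - rewrite H0. field. exact Hn.
  - transitivity (lam * (- (1)) ^ length eta *
      (poch_prod (map (fun e => e + 1) eta) n * prodC eta) / poch_prod eta n); [field; exact Hn|].
    rewrite poch_prod_shift1. field. exact Hn.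
Qed.

Lemma hyp_term_cons (A B : list C) (a b c z : C) (n : nat) :
  hyp_term (a :: b :: A) (c :: B) z n =
  poch a n * (poch b n * poch_prod A n) / (poch c n * poch_prod B n) * z ^ n / # (fact n).
Proof. reflexivity. Qed.

(** Multiplied by [(c)_n n!] this is [transf_coeff_convolution]; the factors match through
    [(c)_n = (c)_j (c+j)_(n-j)]. *)
Lemma hyp_term_convolution (fs : list C) (ms : list nat) (a b c : C) (eta : list C) (lam z : C) (n : nat) :
  let m := list_sum ms in
  length ms = length fs ->
  poch (c - a - # m) m <> 0 -> poch (c - b - # m) m <> 0 ->
  not_nonpos_int c ->
  (forall f, In f fs -> not_nonpos_int f) ->
  (forall k, (k <= m)%nat -> forall n, (n <= k)%nat -> poch (b + # m - # k + 1) n <> 0) ->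
  (forall t, Phat fs ms a b c t = lam * prodC (map (fun e => t - e) eta)) ->
  (forall e, In e eta -> not_nonpos_int e) ->
  convolution
    (hyp_term ((c - a - # m) :: (c - b - # m) :: map (fun e => e + 1) eta) (c :: eta) z)
    (fun n => binom_coeff (a + b + # m - c) n * z ^ n) n =
  hyp_term (a :: b :: shifted fs ms) (c :: fs) z n.
Proof.
  intros m Hl Ha Hb Hc Hf Hbk HP He.
  set (Q := fun n => poch_prod (shifted fs ms) n / poch_prod fs n).
  assert (Hpc : forall j, poch c j <> 0) by (intros j; now apply poch_neq_0).
  assert (Hpf := poch_prod_neq_0 fs n Hf).
  rewrite hyp_term_cons.
  transitivity (poch a n * poch b n * Q n * (z ^ n / (poch c n * # (fact n)))).
  2:{ unfold Q. field. repeat split; auto using fact_neq_0_C. }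
  rewrite <- (transf_coeff_convolution a b c m Q n), bsum_sumC.
  rewrite (Cmult_comm (# (fact n))), <- Cmult_assoc, Cmult_comm, <- sumC_scal.
  unfold convolution. apply sumC_ext. intros j Hj.
  rewrite hyp_term_cons. pose proof (poch_prod_neq_0 eta j He) as Hpe.
  assert (Et : transf_coeff a b c m Q j = poch (c - a - # m) j * poch (c - b - # m) j *
    (poch_prod (map (fun e => e + 1) eta) j / poch_prod eta j)).
  { rewrite (roots_ratio eta (Phat fs ms a b c) lam j HP); [|now apply Phat_0|exact He].
    symmetry. now apply Phat_neg_nat. }
  rewrite Et. unfold binom_coeff.
  replace (poch c n) with (poch c j * poch (c + # j) (n - j))
    by (rewrite <- poch_add; f_equal; lia).
  replace (z ^ n) with (z ^ j * z ^ (n - j)) by (rewrite <- Cpow_add_r; f_equal; lia).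
  assert (Hs : poch (c + # j) (n - j) <> 0).
  { intros E. apply (Hpc n). replace n with (j + (n - j))%nat by lia. rewrite poch_add, E. ring. }
  field. repeat split; auto using fact_neq_0_C.
Qed.

Lemma hyp_term_pow (A B : list C) (z : C) (n : nat) :
  hyp_term A B z n = hyp_term A B (RtoC (/ 2)) n * (RtoC 2 * z) ^ n.
Proof.
  unfold hyp_term, Cdiv. rewrite Cpow_mult_l.
  assert (E : RtoC (/ 2) ^ n * RtoC 2 ^ n = 1).
  { rewrite <- Cpow_mult_l, <- RtoC_mult. replace (/ 2 * 2)%R with 1%R by field. apply Cpow_1_l. }
  transitivity (prodC (map (fun a => poch a n) A) * / prodC (map (fun b => poch b n) B) * z ^ n *
    / # (fact n) * (RtoC (/ 2) ^ n * RtoC 2 ^ n)); [rewrite E|]; ring.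
Qed.

(** Convergence at the single point 1/2 bounds the terms there; passing from 1/2 to [z] multiplies
    the n-th term by [(2z)^n], and [|z| <= 1/8] gives the ratio 1/4 that [cauchy_product] asks
    for. *)
Lemma hyp_term_geometric (A B : list C) (g : C -> C) : is_pFq A B g ->
  exists M, (0 <= M)%R /\ forall z n, (Cmod z <= / 8)%R -> (Cmod (hyp_term A B z n) <= M * (/ 4) ^ n)%R.
Proof.
  intros H.
  assert (H2 : (Cmod (RtoC (/ 2)) < 1)%R) by (rewrite Cmod_R, Rabs_pos_eq; lra).
  destruct (sums_to_bounded _ _ (hyp_series_sums_to A B g _ H H2)) as [M [HM HB]].
  exists M. split; [exact HM|]. intros z n Hz. rewrite hyp_term_pow, Cmod_mult, Cmod_pow.
  apply Rmult_le_compat; [apply Cmod_ge_0|apply pow_le, Cmod_ge_0|apply HB|].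
  apply pow_incr. split; [apply Cmod_ge_0|]. rewrite Cmod_mult, Cmod_R, Rabs_pos_eq; lra.
Qed.

Theorem theorem2 :
  forall (r : nat) (ms : list nat) (fs : list C) (a b c : C)
         (eta : list C) (F1 F2 : C -> C) (x : C),
    (1 <= r)%nat -> length ms = r -> length fs = r ->
    let m := list_sum ms in
    let mC := RtoC (INR m) in
    let fm := map (fun p => fst p + RtoC (INR (snd p))) (combine fs ms) in
    poch (c - a - mC) m <> 0 ->
    poch (c - b - mC) m <> 0 ->
    poch (1 + a + b - c) m <> 0 ->
    (* implicit well-definedness of the hypergeometric expressions *)
    not_nonpos_int c ->
    (forall f, In f fs -> not_nonpos_int f) ->
    (forall k : nat, (k <= m)%nat -> forall n : nat, (n <= k)%nat ->
        poch (b + mC - RtoC (INR k) + 1) n <> 0) ->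
    (* eta = the roots of \hat P_m, listed with multiplicity *)
    length eta = m ->
    (exists lam : C, forall t : C,
        Phat fs ms a b c t = lam * prodC (map (fun e => t - e) eta)) ->
    (forall e, In e eta -> not_nonpos_int e) ->
    (* F1, F2 = principal branches of the two hypergeometric functions *)
    is_pFq (a :: b :: fm) (c :: fs) F1 ->
    is_pFq ((c - a - mC) :: (c - b - mC) :: map (fun e => e + 1) eta) (c :: eta) F2 ->
    slit x ->
    F1 x = Cpow_principal (1 - x) (c - a - b - mC) * F2 x.
Proof.
  intros r ms fs a b c eta F1 F2 x _ Hms Hfs m mC fm Ha Hb _ Hc Hf Hbk _ [lam HP] He HF1 HF2 Hx.
  set (s := c - a - b - mC).
  assert (Hl : length ms = length fs) by congruence.
  set (h := fun z => F1 z + - (1) * (Cpow_principal (1 - z) s * F2 z)).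
  assert (Hh : forall z, slit z -> exists l, cderiv h z l).
  { intros z Hz. destruct (proj1 HF1 z Hz) as [l1 H1]. destruct (proj1 HF2 z Hz) as [l2 H2].
    apply is_derive_cderiv in H1, H2.
    eexists. apply cderiv_plus; [exact H1|]. apply cderiv_scal.
    apply cderiv_mult; [now apply cderiv_Cpow_1_minus|exact H2]. }
  assert (H0 : nearC 0 (fun z => h z = 0)).
  { destruct (hyp_term_geometric _ _ _ HF2) as [M [HM HB2]].
    set (sigma := a + b + mC - c).
    set (K := (Cmod sigma + 1)%R).
    assert (HK : (1 <= K)%R) by (unfold K; pose proof (Cmod_ge_0 sigma); lra).
    assert (HK4 : (0 < / (4 * K))%R) by (apply Rinv_0_lt_compat; lra).
    (* The radius 1/8 serves the terms of [F2], the radius [1/(4K)] those of the binomial series;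
       both then decay with ratio 1/4. *)
    assert (Hsmall : nearC 0 (fun z => (Cmod z < Rmin (/ 8) (/ (4 * K)))%R)).
    { exists (Rmin (/ 8) (/ (4 * K))). split; [apply Rmin_glb_lt; lra|]. intros z Hz.
      replace (z - 0) with z in Hz by ring. exact Hz. }
    generalize (nearC_and _ _ _ Hsmall (binomial_series sigma)). apply nearC_imp.
    intros z [Hz Hbin].
    pose proof (Rmin_l (/ 8) (/ (4 * K))). pose proof (Rmin_r (/ 8) (/ (4 * K))).
    assert (Hz1 : (Cmod z < 1)%R) by lra.
    assert (Hbb : forall n, (Cmod (binom_coeff sigma n * z ^ n) <= 1 * (/ 4) ^ n)%R).
    { intros n. rewrite Cmod_mult, Cmod_pow, Rmult_1_l.
      eapply Rle_trans; [apply Rmult_le_compat_r; [apply pow_le, Cmod_ge_0|apply binom_coeff_le]|].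
      rewrite <- Rpow_mult_distr. apply pow_incr. fold K. split.
      - apply Rmult_le_pos; [lra|apply Cmod_ge_0].
      - replace (/ 4)%R with (K * / (4 * K))%R by (field; lra). apply Rmult_le_compat_l; lra. }
    pose proof (cauchy_product _ _ _ _ M 1 (hyp_series_sums_to _ _ F2 z HF2 Hz1) Hbin HM Rle_0_1
      (fun n => HB2 z n ltac:(lra)) Hbb) as Hprod.
    assert (E : F1 z = F2 z * Cpow_principal (1 - z) (- sigma)).
    { apply (sums_to_unique (hyp_term (a :: b :: fm) (c :: fs) z)).
      - now apply hyp_series_sums_to.
      - revert Hprod. apply sums_to_ext. intros n. now apply (hyp_term_convolution fs ms a b c eta lam z n). }
    unfold h. rewrite E. replace (- sigma) with s by (unfold s, sigma; ring). ring. }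
  pose proof (slit_identity h x Hh H0 Hx) as E. unfold h in E.
  replace (F1 x) with (F1 x + - (1) * (Cpow_principal (1 - x) s * F2 x) + Cpow_principal (1 - x) s * F2 x)
    by ring.
  rewrite E. ring.
Qed.
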